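(* Assume the growth condition, the dynamics condition and the support condition on the data $(\ell,g,A,B,m_0^* )$, and let $N_s\ge N_t$ be positive integers and $\varepsilon>0$. Then there exists at least one $M\in\mathbb M$ such that $M=\mathbf{br}(M)$. In addition, if the monotonicity condition holds, then such an $M$ is unique.
   Context: **Notation.** $|\cdot|$ is the infinity norm on $\mathbb R^n$ and $\overline B_\infty(0,R)$ the closed ball of radius $R$ centred at $0$. $\mathcal P(X)$ is the set of Borel probability measures on $X$; $\mathcal P_1(\mathbb R^d)$ is the set of those with finite first moment, with the Wasserstein distance $d_1(\mu_1,\mu_2)=\inf_{\mu\in\Pi(\mu_1,\mu_2)}\int|x-y|\,d\mu(x,y)$, where $\Pi(\mu_1,\mu_2)$ is the set of $\mu\in\mathcal P_1(\mathbb R^d\times\mathbb R^d)$ with marginals $\mu_1,\mu_2$. **Data.** $T>0$, $\ell:[0,T]\times\mathbb R^r\times\mathbb R^d\times\mathcal P_1(\mathbb R^d)\to\mathbb R$, $g:\mathbb R^d\times\mathcal P_1(\mathbb R^d)\to\mathbb R$, $A:[0,T]\times\mathbb R^d\to\mathbb R^d$, $B:[0,T]\to\mathbb R^{d\times r}$, $m_0^*\in\mathcal P_1(\mathbb R^d)$. *Growth condition.* $\ell,g$ are continuous and there are $p\in]1,\infty[$ and positive constants $C_{\ell,1},\dots,C_{\ell,4},C_{g,1},C_{g,2},C_{g,3}$ such that for all $(t,a,x,\mu)$ and all $y\in\mathbb R^d$: $C_{\ell,1}|a|^p-C_{\ell,2}\le\ell(t,a,x,\mu)\le C_{\ell,3}(1+|a|^p+|x|^p)$;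 $-C_{g,1}\le g(x,\mu)\le C_{g,2}(1+|x|^p)$; $|\ell(t,a,x,\mu)-\ell(t,a,y,\mu)|\le C_{\ell,4}(1+|x|^{p-1}+|y|^{p-1}+|a|^{p-1})|x-y|$; $|g(x,\mu)-g(y,\mu)|\le C_{g,3}(1+|x|^{p-1}+|y|^{p-1})|x-y|$. *Dynamics condition.* $A,B$ are continuous; there is $L_A>0$ with $|A(t,x)-A(t,y)|\le L_A|x-y|$ for all $t,x,y$; $r\le d$ and there are $\{i_1,\dots,i_r\}\subset\{1,\dots,d\}$ such that for all $t\in[0,T]$ the rows $i_1,\dots,i_r$ of $B(t)$ are linearly independent. *Support condition.* There is $C^*>0$ with $\mathrm{supp}(m_0^* )\subset\overline B_\infty(0,C^* )$. *Monotonicity condition.* (i) $\ell(t,a,x,\mu)=\ell_0(t,a,x)+f(t,x,\mu)$, where $\ell_0:[0,T]\times\mathbb R^r\times\mathbb R^d\to\mathbb R$ is continuous and satisfies the inequalities required of $\ell$ in the growth condition, and $f:[0,T]\times\mathbb R^d\times\mathcal P_1(\mathbb R^d)\to\mathbb R$ is continuous, bounded, and satisfies $|f(t,x,\mu)-f(t,y,\mu)|\le L_f|x-y|$ for some $L_f>0$ and all $t,\mu,x,y$. (ii) For $\Psi=f(t,\cdot,\cdot)$ (all $t\in[0,T]$) and $\Psi=g$: $\int_{\mathbb R^d}(\Psi(x,\mu_1)-\Psi(x,\mu_2))\,d(\mu_1-\mu_2)(x)\ge0$ for all $\mu_1,\mu_2\in\mathcal P_1(\mathbb R^d)$. **Control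 bound.** For $m\in C([0,T];\mathcal P_1(\mathbb R^d))$, $(t,x)\in[0,T]\times\mathbb R^d$ and $\alpha\in L^p([t,T];\mathbb R^r)$ let $\gamma^{t,x,\alpha}$ solve $\dot\gamma=A(s,\gamma)+B(s)\alpha$ on $]t,T[$, $\gamma(t)=x$. Let $v[m](t,x)$ be the infimum over $\alpha\in L^p([t,T];\mathbb R^r)$ of $\int_t^T\ell(s,\alpha(s),\gamma^{t,x,\alpha}(s),m(s))ds+g(\gamma^{t,x,\alpha}(T),m(T))$. Under the growth and dynamics conditions there is $C_{\mathrm b}>0$, independent of $(t,x,m)$, such that $v[m](t,x)$ is always attained at some $\alpha^*$ with $|\alpha^*(s)|\le C_{\mathrm b}(1+|\gamma^{t,x,\alpha^*}(s)|)$ for a.e. $s\in[t,T]$; such a $C_{\mathrm b}$ is fixed. **Grids.** For positive integers $N_s\ge N_t$ set $\Delta t=T/N_t$, $\Delta x=1/N_s$, $\mathcal I=\{0,\dots,N_t\}$, $\mathcal I^*=\mathcal I\setminus\{N_t\}$, $t_k=k\Delta t$, $\mathcal G_q=\{i\Delta x: i\in\mathbb Z^q\}$, $\mathcal G=\mathcal G_d=\mathcal G_r\times\mathcal G_{d-r}$. The coordinates are ordered so that, writing $x=(\mathrm x_1,\mathrm x_2)\in\mathbb R^r\times\mathbb R^{d-r}$, $A=(A_1,A_2)$, $B=\binom{B_1}{B_2}$ accordingly, $B_1(t)\in\mathbb R^{r\times r}$ is invertible for all $t$. $(\beta_{\mathrm x_2})_{\mathrm x_2\in\mathcal G_{d-r}}$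 is a $\mathbb Q_1$ basis on a regular mesh with vertices $\mathcal G_{d-r}$: each $\beta_{\mathrm x_2}\ge0$ is polynomial of partial degree at most $1$ on each mesh element, $\beta_{\mathrm x_2}(\mathrm x_2)=1$, $\beta_{\mathrm x_2}(\mathrm y_2)=0$ for $\mathrm y_2\in\mathcal G_{d-r}\setminus\{\mathrm x_2\}$, $\sum_{\mathrm x_2}\beta_{\mathrm x_2}\equiv1$; and $\mathrm{supp}(\beta_{\mathrm x_2})\subseteq\{\mathrm y_2:|\mathrm y_2-\mathrm x_2|\le C_I\Delta x\}$ with $C_I>0$ independent of $\Delta x$. For $k\in\mathcal I^*$, $x\in\mathbb R^d$, $\mathrm y_1\in\mathcal G_r$ put $$\alpha(k,x,\mathrm y_1)=B_1(t_k)^{-1}\Big[\tfrac{\mathrm y_1-\mathrm x_1}{\Delta t}-A_1(t_k,x)\Big],\qquad \mathbf y_2(k,x,\mathrm y_1)=\mathrm x_2+\Delta t\,[A_2(t_k,x)+B_2(t_k)\alpha(k,x,\mathrm y_1)],$$ $\mathcal S^1_{k+1}(x)=\{\mathrm y_1\in\mathcal G_r:|\alpha(k,x,\mathrm y_1)|\le C_{\mathrm b}(1+|x|)\}$, $\mathcal S^2_{k+1}(x,\mathrm y_1)=\{\mathrm y_2\in\mathcal G_{d-r}:\mathbf y_2(k,x,\mathrm y_1)\in\mathrm{supp}\,\beta_{\mathrm y_2}\}$, $\mathcal S_{k+1}(x)=\{(\mathrm y_1,\mathrm y_2):\mathrm y_1\in\mathcal S^1_{k+1}(x),\mathrm y_2\in\mathcal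 S^2_{k+1}(x,\mathrm y_1)\}$, $\mathcal S_0=\mathcal G\cap\overline B_\infty(0,C^* )$, $\mathcal S_{k+1}=\bigcup_{x\in\mathcal S_k}\mathcal S_{k+1}(x)$. It is understood that the sets $\mathcal S_{k+1}(x)$, $x\in\mathcal S_k$, are nonempty (which holds when $\Delta x/\Delta t$ is small enough). For $F\subseteq\mathcal G_{d-r}$ and $\varphi:F\to\mathbb R$, $I_F[\varphi](\mathrm y_2)=\sum_{\mathrm x_2\in F}\beta_{\mathrm x_2}(\mathrm y_2)\varphi(\mathrm x_2)$. **Finite MFG.** Let $\mathbb M=\prod_{k\in\mathcal I}\mathcal P(\mathcal S_k)$; $p\in\mathcal P(\mathcal S_k)$ is identified with $\sum_{x\in\mathcal S_k}p(x)\delta_x\in\mathcal P_1(\mathbb R^d)$. For a finite set $F$, $\mathcal E_F(p)=\sum_{x\in F}p(x)\log p(x)$ ($0\log0=0$). Given $M\in\mathbb M$ and $\varepsilon>0$, set $V^M_{N_t}(x)=g(x,M_{N_t})$ for $x\in\mathcal S_{N_t}$ and, for $k\in\mathcal I^*$, $x\in\mathcal S_k$, $$V^M_k(x)=\min_{p\in\mathcal P(\mathcal S^1_{k+1}(x))}\Big\{\sum_{\mathrm y_1\in\mathcal S^1_{k+1}(x)}p(\mathrm y_1)\Big[\Delta t\,\ell(t_k,\alpha(k,x,\mathrm y_1),x,M_k)+I_{\mathcal S^2_{k+1}(x,\mathrm y_1)}[V^M_{k+1}(\mathrm y_1,\cdot)](\mathbf y_2(k,x,\mathrm y_1))\Big]+\varepsilon\,\mathcal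 E_{\mathcal S^1_{k+1}(x)}(p)\Big\},$$ with unique minimizer $p^M_k(x,\cdot)$. Set $P^M_k(x,y)=p^M_k(x,\mathrm y_1)\beta_{\mathrm y_2}(\mathbf y_2(k,x,\mathrm y_1))$ if $y\in\mathcal S_{k+1}(x)$ and $P^M_k(x,y)=0$ if $y\in\mathcal S_{k+1}\setminus\mathcal S_{k+1}(x)$. With $E(x)=\{y\in\mathbb R^d:|x-y|\le\Delta x/2\}$, the best response $\mathbf{br}(M)=\widehat M$ is defined by $\widehat M_0(x)=m_0^*(E(x))$ for $x\in\mathcal S_0$ and $\widehat M_{k+1}(y)=\sum_{x\in\mathcal S_k}P^M_k(x,y)\widehat M_k(x)$ for $k\in\mathcal I^*$, $y\in\mathcal S_{k+1}$. It is understood that $\widehat M_0$ is a probability on $\mathcal S_0$, so that $\mathbf{br}:\mathbb M\to\mathbb M$. *)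

(* Defs.v *)
From HB Require Import structures.
From mathcomp Require Import all_boot all_order all_algebra.
From mathcomp Require Import all_classical all_reals all_analysis.
From mathcomp Require Import measurable_realfun.

Set Implicit Arguments.
Unset Strict Implicit.
Unset Printing Implicit Defensive.

Import Order.TTheory GRing.Theory Num.Theory.
Import numFieldNormedType.Exports.

Local Open Scope classical_set_scope.
Local Open Scope ring_scope.

(* R^n is 'cV[R]_n; its library norm and topology are those of the infinity
   norm, for every n (including 0). *)

Definition continuous_on {X Y : nbhsType} (D : set X) (f : X -> Y) : Prop :=
  forall z, D z -> f @ within D (nbhs z) --> f z.

Section wasserstein.
Context {R : realType} {n : nat}.

Definition borel : measurableType _ := g_sigma_algebraType (@open 'cV[R]_n).

Record P1 := MkP1 {
  P1_prob :> probability borel R ;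
  P1_moment : (\int[P1_prob]_x (`|x : 'cV[R]_n|)%:E < +oo)%E }.

(* The product sigma-algebra on [borel * borel] is the Borel sigma-algebra of
   R^n x R^n, as these spaces are second countable. *)
Definition coupling (mu1 mu2 : P1) (mu : probability (borel * borel)%type R)
    : Prop :=
  [/\ (\int[mu]_z (Num.max `|z.1 : 'cV[R]_n| `|z.2 : 'cV[R]_n|)%:E < +oo)%E,
      forall E : set borel, measurable E -> mu (fst @^-1` E) = P1_prob mu1 E &
      forall E : set borel, measurable E -> mu (snd @^-1` E) = P1_prob mu2 E].

Definition d1 (mu1 mu2 : P1) : \bar R :=
  ereal_inf [set (\int[mu]_z (`|(z.1 : 'cV[R]_n) - z.2|)%:E)%E
            | mu in coupling mu1 mu2].

HB.instance Definition _ := gen_eqMixin P1.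
HB.instance Definition _ := gen_choiceMixin P1.
HB.instance Definition _ := hasNbhs.Build P1 (fun mu =>
  filter_from [set e : R | 0 < e]
    (fun e => [set nu : P1 | (d1 mu nu < e%:E)%E])).

Definition msupport (mu : P1) : set 'cV[R]_n :=
  [set x | forall U : set 'cV[R]_n, open U -> U x -> (0 < P1_prob mu U)%E].

End wasserstein.
Arguments borel : clear implicits.
Arguments P1 : clear implicits.

Section finite_probabilities.
Context {R : realType} {n : nat}.

(* All sums over subsets of R^n below are the finitely supported sums of
   fsbigop: they are only used on finite sets, or (partition of unity) for
   locally finite families. *)
Definition prob_on (S : set 'cV[R]_n) (p : 'cV[R]_n -> R) : Prop :=
  [/\ forall x, 0 <= p x, forall x, ~ S x -> p x = 0 &
      \sum_(x \in S) p x = 1].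

Record fprob (S : set 'cV[R]_n) := FProb {
  fprob_val :> 'cV[R]_n -> R ;
  fprob_prop : prob_on S fprob_val }.

(* [ln 0 = 0] in the library, hence 0 log 0 = 0 *)
Definition entropy (F : set 'cV[R]_n) (p : 'cV[R]_n -> R) : R :=
  \sum_(x \in F) p x * ln (p x).

Section dirac_sum.
Context {S : set 'cV[R]_n} (p : fprob S).

Let s : seq 'cV[R]_n := finite_support 0 S (fprob_val p).

Fact fprob_ge0 x : 0 <= p x.
Proof. by have [] := fprob_prop p. Qed.

(* \sum_(x in S) p x *: \d_x *)
Definition dirac_sum : set (borel R n) -> \bar R :=
  msum (fun i => mscale (NngNum (fprob_ge0 (nth 0 s i)))
                        (@dirac _ (borel R n) (nth 0 s i) R)) (size s).

HB.instance Definition _ := Measure.on dirac_sum.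

Fact dirac_sum_setT : dirac_sum setT = 1%E.
Proof.
rewrite /dirac_sum /msum.
transitivity (\sum_(i < size s) (p (nth 0 s i))%:E)%E.
  by apply: eq_bigr => i _; rewrite /= /mscale/= diracT mule1.
rewrite sumEFin; congr EFin.
have [_ _ <-] := fprob_prop p.
by rewrite (big_nth 0) big_mkord.
Qed.

HB.instance Definition _ :=
  Measure_isProbability.Build _ _ _ dirac_sum dirac_sum_setT.

Fact dirac_sum_moment : (\int[dirac_sum]_x (`|x : 'cV[R]_n|)%:E < +oo)%E.
Proof.
have mN : measurable_fun [set: borel R n]
    ((fun x => `|x : 'cV[R]_n|) : borel R n -> R).
  apply: (measurability _ (RGenOpens.measurableE R)).
  move=> _ [_ [a [b ->]] <-]; rewrite setTI; apply: sub_sigma_algebra => /=.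
  have /continuousP := @norm_continuous R 'cV[R]_n.
  by apply; exact: interval_open.
have mNE : measurable_fun [set: borel R n]
    (EFin \o ((fun x => `|x : 'cV[R]_n|) : borel R n -> R)).
  exact/measurable_EFinP.
rewrite ge0_integral_measure_sum//=.
apply: lte_sum_pinfty => i _.
rewrite ge0_integral_mscale//= integral_dirac//= diracT mul1e.
by rewrite -EFinM ltry.
Qed.

Definition toP1 : P1 R n := MkP1 dirac_sum_moment.

End dirac_sum.
End finite_probabilities.

Section mfg.
Context {R : realType} {r q : nat}.
Local Notation d := (r + q)%N.

Record mfg_data := MFGData {
  horizon : R ;
  ell : R -> 'cV[R]_r -> 'cV[R]_d -> P1 R d -> R ;
  gT : 'cV[R]_d -> P1 R d -> R ;
  drift : R -> 'cV[R]_d -> 'cV[R]_d ;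
  ctrl : R -> 'M[R]_(d, r) ;
  m0 : P1 R d }.

Variable D : mfg_data.
Local Notation T := (horizon D).
Local Notation leb := (@lebesgue_measure R).

Definition running_growth (p : R)
    (l : R -> 'cV[R]_r -> 'cV[R]_d -> P1 R d -> R) : Prop :=
  exists C1 C2 C3 C4 : R, [/\ 0 < C1, 0 < C2, 0 < C3 & 0 < C4] /\
  forall t a x mu, 0 <= t <= T ->
    [/\ C1 * `|a| `^ p - C2 <= l t a x mu,
        l t a x mu <= C3 * (1 + `|a| `^ p + `|x| `^ p) &
        forall y, `|l t a x mu - l t a y mu| <=
          C4 * (1 + `|x| `^ (p - 1) + `|y| `^ (p - 1) + `|a| `^ (p - 1))
             * `|x - y| ].

Definition terminal_growth (p : R) (g : 'cV[R]_d -> P1 R d -> R) : Prop :=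
  exists C1 C2 C3 : R, [/\ 0 < C1, 0 < C2 & 0 < C3] /\
  forall x mu,
    [/\ - C1 <= g x mu, g x mu <= C2 * (1 + `|x| `^ p) &
        forall y, `|g x mu - g y mu| <=
          C3 * (1 + `|x| `^ (p - 1) + `|y| `^ (p - 1)) * `|x - y| ].

Definition running_continuous
    (l : R -> 'cV[R]_r -> 'cV[R]_d -> P1 R d -> R) : Prop :=
  continuous_on
    [set z : R * 'cV[R]_r * 'cV[R]_d * P1 R d | 0 <= z.1.1.1 <= T]
    (fun z => l z.1.1.1 z.1.1.2 z.1.2 z.2).

Definition growth_condition (p : R) : Prop :=
  [/\ 1 < p, running_continuous (ell D), running_growth p (ell D),
      continuous_on [set: 'cV[R]_d * P1 R d] (fun z => gT D z.1 z.2) &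
      terminal_growth p (gT D)].

Definition dynamics_condition : Prop :=
  [/\ continuous_on [set z : R * 'cV[R]_d | 0 <= z.1 <= T]
        (fun z => drift D z.1 z.2),
      continuous_on `[0, T] (ctrl D),
      exists2 L : R, 0 < L & forall t x y, 0 <= t <= T ->
        `|drift D t x - drift D t y| <= L * `|x - y| &
      exists2 f : 'I_r -> 'I_d, injective f & forall t, 0 <= t <= T ->
        row_free (rowsub f (ctrl D t))].

Definition support_condition (Cstar : R) : Prop :=
  0 < Cstar /\ msupport (m0 D) `<=` [set x | `|x| <= Cstar].

(* For mu1, mu2 in P_1 the integrand may have growth p > 1 when Psi = g, so the
   inequality is required only when the integral against mu1 - mu2 makes
   sense. *)
Definition monotone (Psi : 'cV[R]_d -> P1 R d -> R) : Prop :=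
  forall mu1 mu2 : P1 R d,
    let h : borel R d -> \bar R := fun x => (Psi x mu1 - Psi x mu2)%:E in
    (P1_prob mu1).-integrable setT h -> (P1_prob mu2).-integrable setT h ->
    (0 <= \int[P1_prob mu1]_x h x - \int[P1_prob mu2]_x h x)%E.

Definition monotonicity_condition (p : R) : Prop :=
  exists (l0 : R -> 'cV[R]_r -> 'cV[R]_d -> R)
         (f : R -> 'cV[R]_d -> P1 R d -> R),
  [/\ forall t a x mu, 0 <= t <= T -> ell D t a x mu = l0 t a x + f t x mu,
      continuous_on [set z : R * 'cV[R]_r * 'cV[R]_d | 0 <= z.1.1 <= T]
        (fun z => l0 z.1.1 z.1.2 z.2) /\
      running_growth p (fun t a x _ => l0 t a x),
      [/\ continuous_on [set z : R * 'cV[R]_d * P1 R d | 0 <= z.1.1 <= T]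
            (fun z => f z.1.1 z.1.2 z.2),
          exists C : R, forall t x mu, 0 <= t <= T -> `|f t x mu| <= C &
          exists2 L : R, 0 < L & forall t x y mu, 0 <= t <= T ->
            `|f t x mu - f t y mu| <= L * `|x - y| ],
      forall t, 0 <= t <= T -> monotone (f t) &
      monotone (gT D)].

Definition Lp_control (p t : R) (a : R -> 'cV[R]_r) : Prop :=
  measurable_fun `[t, T] (a : R -> borel R r) /\
  (\int[leb]_(s in `[t, T]) (`|a s| `^ p)%:E < +oo)%E.

(* For an integrable control the ODE is understood in the sense of
   Caratheodory, i.e. as the integral equation. *)
Definition trajectory (t : R) (x : 'cV[R]_d) (a : R -> 'cV[R]_r)
    (gam : R -> 'cV[R]_d) : Prop :=
  continuous_on `[t, T] gam /\
  forall s i, t <= s <= T ->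
    gam s i 0 = x i 0 +
      \int[leb]_(u in `[t, s]) (drift D u (gam u) + ctrl D u *m a u) i 0.

Definition cost (m : R -> P1 R d) (t : R) (a : R -> 'cV[R]_r)
    (gam : R -> 'cV[R]_d) : \bar R :=
  (\int[leb]_(s in `[t, T]) (ell D s (a s) (gam s) (m s))%:E
   + (gT D (gam T) (m T))%:E)%E.

Definition value (p : R) (m : R -> P1 R d) (t : R) (x : 'cV[R]_d) : \bar R :=
  ereal_inf [set c | exists a gam,
    [/\ Lp_control p t a, trajectory t x a gam & c = cost m t a gam]].

Definition control_bound (p Cb : R) : Prop :=
  0 < Cb /\
  forall m : R -> P1 R d, continuous_on `[0, T] m ->
  forall t x, 0 <= t <= T -> exists a gam,
    [/\ Lp_control p t a, trajectory t x a gam,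
        cost m t a gam = value p m t x &
        {ae leb, forall s, t <= s <= T -> `|a s| <= Cb * (1 + `|gam s|)}].

End mfg.
Arguments mfg_data : clear implicits.

Section grids.
Context {R : realType}.

Definition grid (n : nat) (dx : R) : set 'cV[R]_n :=
  [set x | exists i : 'cV[int]_n, x = dx *: map_mx intr i].

Definition mesh_cell (n : nat) (dx : R) (i : 'cV[int]_n) : set 'cV[R]_n :=
  [set y | forall j, (i j 0)%:~R * dx <= y j 0 <= (i j 0 + 1)%:~R * dx].

(* [c J] is the coefficient of the monomial \prod_(j in J) y_j. *)
Definition Q1_poly (n : nat) (c : {set 'I_n} -> R) (y : 'cV[R]_n) : R :=
  \sum_(J : {set 'I_n}) c J * \prod_(j in J) y j 0.

(* The mesh is the one of the cubes of side [dx] with vertices in the grid;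
   [beta x] is only meaningful for [x] in the grid. *)
Definition Q1_basis (n : nat) (dx CI : R)
    (beta : 'cV[R]_n -> 'cV[R]_n -> R) : Prop :=
  [/\ forall x, grid dx x -> forall y, 0 <= beta x y,
      forall x i, grid dx x -> exists c,
        forall y, mesh_cell dx i y -> beta x y = Q1_poly c y,
      forall x y, grid dx x -> grid dx y -> beta x y = (x == y)%:R,
      forall y, \sum_(x \in grid dx) beta x y = 1 &
      forall x, grid dx x ->
        closure [set y | beta x y != 0] `<=` [set y | `|y - x| <= CI * dx]].

End grids.

Definition argmin {X : pointedType} {R : realType} (P : set X) (J : X -> R)
    : X :=
  get [set p | P p /\ forall p', P p' -> J p <= J p'].

Section finite_mfg.
Context {R : realType} {r q : nat}.
Local Notation d := (r + q)%N.
Variables (D : mfg_data R r q) (Cstar Cb : R) (Nt Ns : nat).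
Variable beta : 'cV[R]_q -> 'cV[R]_q -> R.

Definition dt : R := horizon D / Nt%:R.
Definition dx : R := Ns%:R^-1.
Definition time (k : nat) : R := k%:R * dt.

Definition alpha (k : nat) (x : 'cV[R]_d) (y1 : 'cV[R]_r) : 'cV[R]_r :=
  invmx (usubmx (ctrl D (time k))) *m
    (dt^-1 *: (y1 - usubmx x) - usubmx (drift D (time k) x)).

Definition ybar (k : nat) (x : 'cV[R]_d) (y1 : 'cV[R]_r) : 'cV[R]_q :=
  dsubmx x + dt *: (dsubmx (drift D (time k) x)
                    + dsubmx (ctrl D (time k)) *m alpha k x y1).

(* [S1 k x], [S2 k x y1], [reach k x] consist of points of time step k + 1:
   they are S^1_(k+1)(x), S^2_(k+1)(x, y1), S_(k+1)(x). *)
Definition S1 (k : nat) (x : 'cV[R]_d) : set 'cV[R]_r :=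
  [set y1 | grid dx y1 /\ `|alpha k x y1| <= Cb * (1 + `|x|)].

Definition S2 (k : nat) (x : 'cV[R]_d) (y1 : 'cV[R]_r) : set 'cV[R]_q :=
  [set y2 | grid dx y2 /\ closure [set z | beta y2 z != 0] (ybar k x y1)].

Definition reach (k : nat) (x : 'cV[R]_d) : set 'cV[R]_d :=
  [set y | S1 k x (usubmx y) /\ S2 k x (usubmx y) (dsubmx y)].

Fixpoint states (k : nat) : set 'cV[R]_d :=
  match k with
  | 0 => [set x | grid dx x /\ `|x| <= Cstar]
  | j.+1 => \bigcup_(x in states j) reach j x
  end.

Definition interp (F : set 'cV[R]_q) (phi : 'cV[R]_q -> R) (y : 'cV[R]_q) : R :=
  \sum_(z \in F) beta z y * phi z.

Definition mfg_space : Type := forall k : 'I_Nt.+1, fprob (states k).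

Variables (eps : R) (M : mfg_space).

Definition flow (k : nat) : P1 R d := toP1 (M (inord k)).

Definition bellman (k : nat) (x : 'cV[R]_d) (W : 'cV[R]_d -> R)
    (p : 'cV[R]_r -> R) : R :=
  \sum_(y1 \in S1 k x)
     p y1 * (dt * ell D (time k) (alpha k x y1) x (flow k)
             + interp (S2 k x y1) (fun y2 => W (col_mx y1 y2)) (ybar k x y1))
  + eps * entropy (S1 k x) p.

Definition bellman_argmin (k : nat) (x : 'cV[R]_d) (W : 'cV[R]_d -> R)
    : 'cV[R]_r -> R :=
  argmin (prob_on (S1 k x)) (bellman k x W).

(* [value_rev j] is the value function V_(Nt - j). *)
Fixpoint value_rev (j : nat) : 'cV[R]_d -> R :=
  match j with
  | 0 => fun x => gT D x (flow Nt)
  | i.+1 => fun x => let k := (Nt - i.+1)%N in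
      bellman k x (value_rev i) (bellman_argmin k x (value_rev i))
  end.

Definition V (k : nat) : 'cV[R]_d -> R := value_rev (Nt - k).

Definition policy (k : nat) (x : 'cV[R]_d) : 'cV[R]_r -> R :=
  bellman_argmin k x (V k.+1).

Definition transition (k : nat) (x y : 'cV[R]_d) : R :=
  if `[< reach k x y >]
  then policy k x (usubmx y) * beta (dsubmx y) (ybar k x (usubmx y))
  else 0.

Definition init_mass (x : 'cV[R]_d) : R :=
  if `[< states 0 x >]
  then fine (P1_prob (m0 D) [set y : 'cV[R]_d | `|x - y| <= dx / 2])
  else 0.

Fixpoint best_response (k : nat) : 'cV[R]_d -> R :=
  match k with
  | 0 => init_mass
  | j.+1 => fun y => \sum_(x \in states j) transition j x y * best_response j x
  end.

Definition equilibrium : Prop :=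
  forall (k : 'I_Nt.+1) x, states k x -> M k x = best_response k x.

End finite_mfg.

(* Main.v *)
Require Import Defs.
From HB Require Import structures.
From mathcomp Require Import all_boot all_order all_algebra.

(* Existence is a fixed point argument on the product of the simplices P(S_k).  By
   the Gibbs variational principle the entropy-penalized Bellman problem is solved
   by exp(-cost/eps)/Z, so the policies, and hence the best response, depend
   continuously on M (weights on a fixed finite set to d_1: couple the common mass
   with itself).  Brouwer's theorem comes from Scarf's combinatorial lemma: label
   each point x of a fine lattice in the simplex by some i with x_i <= f(x)_i; a
   parity argument gives a small set that carries every label i in some C and
   leaves almost no mass outside C, so a limit point satisfies x <= f(x), that is,
   x = f(x).

   For uniqueness, the loss of a non-optimal policy in Bellman's equation is eps
   times a relative entropy.  Along the time steps the pairing <M - M', V - V'>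
   therefore decreases by the monotonicity terms plus relative entropies between
   the two policies, weighted by the flows.  It is 0 initially and nonnegative
   finally, so the relative entropies vanish, the policies agree wherever there is
   mass, and the flows coincide step by step. *)

Set Implicit Arguments.
Unset Strict Implicit.
Unset Printing Implicit Defensive.

(** * Scarf's lemma *)

Section labelled_sets.
Context {Z I : finType}.
Implicit Types (W : {set Z}) (lab : Z -> I).

(** If [W] carries all labels, [lab] is injective on [W] and only the element labelled [i0] can be
    removed. Otherwise, once some [w] can be removed, the label of [w] occurs at exactly one other
    element [w'], and [w], [w'] are the two removable ones. *)
Lemma odd_almost_labelled lab (i0 : I) W : #|W| = #|I| ->
  odd #|[set w in W | lab @: (W :\ w) == ~: [set i0]]| = (lab @: W == setT).
Proof.
move=> cW; set Q := [set w in W | _].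
have inj w : w \in Q -> {in W :\ w &, injective lab}.
  rewrite inE => /andP[wW /eqP E]; apply/imset_injP/eqP.
  by rewrite E cardsC1 -cW (cardsD1 w W) wW add1n.
have [full|nfull] := boolP (lab @: W == setT).
  have injW : {in W &, injective lab}.
    by apply/imset_injP; rewrite (eqP full) cardsT cW.
  have : i0 \in lab @: W by rewrite (eqP full) inE.
  case/imsetP=> w0 w0W ew0; suff -> : Q = [set w0] by rewrite cards1.
  apply/setP=> w; rewrite !inE; apply/andP/eqP => [[wW /eqP E]|->].
    apply/eqP; apply: contraT => ww0.
    have : i0 \in lab @: (W :\ w).
      by apply/imsetP; exists w0; rewrite // !inE eq_sym ww0.
    by rewrite E !inE eqxx.
  split=> //; apply/eqP/setP => i; rewrite !inE; apply/imsetP/idP.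
    case=> v; rewrite !inE => /andP[vw0 vW] ->; rewrite ew0.
    by apply: contra vw0 => /eqP /injW ->.
  have : i \in lab @: W by rewrite (eqP full) inE.
  case/imsetP=> v vW -> ne; exists v => //; rewrite !inE vW andbT.
  by apply: contra ne => /eqP ->; rewrite ew0.
have [->|[w wQ]] := set_0Vmem Q; first by rewrite cards0.
move: (wQ); rewrite inE => /andP[wW /eqP E].
have lw : lab w != i0.
  apply: contra nfull => /eqP lw; apply/eqP.
  by rewrite -(setD1K wW) imsetU1 E lw setUCr.
have : lab w \in lab @: (W :\ w) by rewrite E !inE.
case/imsetP=> w'; rewrite !inE => /andP[w'w w'W] ll.
suff -> : Q = [set w; w'] by rewrite cards2 eq_sym w'w.
apply/setP => x; rewrite !inE; apply/idP/idP.
  move=> xQ; apply: contraT; rewrite negb_or => /andP[xw xw'].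
  have xQ' : x \in Q by rewrite inE.
  by move/eqP: w'w; case; apply: (inj _ xQ'); rewrite ?inE ?(eq_sym _ x) ?xw ?xw'.
case/orP=> /eqP ->; first by rewrite wW E eqxx.
rewrite w'W -E; apply/eqP/setP => i; apply/imsetP/imsetP => -[z].
  rewrite !inE => /andP[zw' zW] ->.
  have [->|zw] := eqVneq z w; first by exists w'; rewrite // !inE w'w.
  by exists z; rewrite // !inE zw.
rewrite !inE => /andP[zw zW] ->.
have [->|zw'] := eqVneq z w'; first by exists w; rewrite // !inE eq_sym w'w.
by exists z; rewrite // !inE zw'.
Qed.

End labelled_sets.

(** * Dominant sets and door counting *)

Section dominant_sets.
Context {Z I : finType} (u : I -> Z -> nat).
Hypothesis u_inj : forall i, injective (u i).
Implicit Types (W : {set Z}) (lab : Z -> I).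

(** Scarf's primitive sets together with their subsets: no [y] lies strictly above the minimum of
    [W] in all the orderings [u i] at once. *)
Definition dominant W :=
  [forall y, [exists i, [forall w in W, u i y <= u i w]]].

Lemma dominantP W :
  reflect (forall y, exists i, forall w, w \in W -> u i y <= u i w) (dominant W).
Proof.
apply: (iffP forallP) => H y.
  by have /existsP[i /forall_inP] := H y; exists i.
by have [i Hi] := H y; apply/existsP; exists i; apply/forall_inP.
Qed.

Lemma dominant_sub W W' : W \subset W' -> dominant W' -> dominant W.
Proof.
move=> /subsetP sW /dominantP dW; apply/dominantP => y.
by have [i Hi] := dW y; exists i => w /sW /Hi.
Qed.

(* The new elements of the two dominant supersets are the [u i]- and the
   [u j]-largest elements above all other minima, [i] and [j] being the two
   indices with the same minimizer in [W]. *)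
Lemma card_dominant_extensions W : dominant W -> #|W|.+1 = #|I| ->
  W != set0 ->
  (forall i, exists y, forall k, k != i -> exists2 w, w \in W & u k w < u k y) ->
  #|[set w | w \notin W & dominant (w |: W)]| = 2.
Proof.
move=> dW cW /set0Pn[w0 w0W] hY.
pose mn k := [arg min_(s < w0 in W) u k s].
have mnW k : mn k \in W by rewrite /mn; case: arg_minnP.
have mn_min k w : w \in W -> u k (mn k) <= u k w.
  by rewrite /mn; case: arg_minnP => // s _ H /H.
have mn_eq k w : w \in W -> (forall v, v \in W -> u k w <= u k v) -> mn k = w.
  move=> wW H; apply: (@u_inj k); apply/eqP.
  by rewrite eqn_leq mn_min // H.
have surj w : w \in W -> exists k, mn k = w.
  by move=> wW; have [k Hk] := dominantP _ dW w; exists k; apply: mn_eq.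
(* There is one index more than elements of [W], so two indices share their minimizer. *)
have /injectivePn[i [j ij mij]] : ~~ injectiveb mn.
  apply/injectiveP => inj; suff : #|I| <= #|W| by rewrite -cW ltnn.
  rewrite -(card_codom inj); apply/subset_leq_card/subsetP => w /codomP[k ->].
  exact: mnW.
have surj' a b : b != a -> mn a = mn b ->
    forall w, w \in W -> exists2 k, k != a & mn k = w.
  move=> ba mab w /surj[k <-]; have [->|ka] := eqVneq k a; last by exists k.
  by exists b.
(* [Y a] collects the points above all minima except possibly that of [a]. Adding its [u a]-largest
   element keeps [W] dominant when [a] shares its minimizer with another index. *)
pose Y a := [set y | [forall k, (k != a) ==> (u k (mn k) < u k y)]].
have YP a y : y \in Y a -> forall k, k != a -> u k (mn k) < u k y.
  by rewrite inE => /forallP H k ka; have /implyP := H k; apply.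
have Yn a b : b != a -> mn a = mn b -> exists y, y \in Y a.
  move=> ba mab; have [y Hy] := hY a; exists y; rewrite inE.
  apply/forallP => k; apply/implyP => /Hy[w wW].
  by apply: leq_ltn_trans; exact: mn_min.
have ext a b : b != a -> mn a = mn b ->
    exists y, [/\ y \in Y a, y \notin W, dominant (y |: W) &
      forall z, z \in Y a -> u a z <= u a y].
  move=> ba mab; have [y0 y0Y] := Yn _ _ ba mab.
  pose y := [arg max_(s > y0 in Y a) u a s]; exists y.
  rewrite /y; case: arg_maxnP => // {}y yY ymax.
  have yW : y \notin W.
    apply/negP => yW; have [k ka E] := surj' _ _ ba mab _ yW.
    by have := YP _ _ yY k ka; rewrite E ltnn.
  split=> //; apply/dominantP => z.
  have [zY|] := boolP (z \in Y a).
    exists a => w; rewrite !inE => /orP[/eqP ->|wW]; first exact: ymax.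
    have [k Hk] := dominantP _ dW z.
    have [ka|ka] := eqVneq k a; first by rewrite -ka; exact: Hk.
    by have := leq_trans (YP _ _ zY k ka) (Hk _ (mnW k)); rewrite ltnn.
  rewrite inE negb_forall => /existsP[k]; rewrite negb_imply -leqNgt.
  case/andP=> ka zk; exists k => w; rewrite !inE => /orP[/eqP ->|wW].
    exact: leq_trans zk (ltnW (YP _ _ yY k ka)).
  exact: leq_trans zk (mn_min _ _ wW).
have ji : j != i by rewrite eq_sym.
have [x [xY xW dx xmax]] := ext i j ji mij.
have [y [yY yW dy ymax]] := ext j i ij (esym mij).
have xy : x != y.
  apply/eqP => exy; have [k Hk] := dominantP _ dW x.
  suff : u k (mn k) < u k x by rewrite ltnNge Hk.
  have [ki|ki] := eqVneq k i; last exact: YP ki.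
  by rewrite ki exy; apply: YP yY _ ij.
suff -> : [set w | w \notin W & dominant (w |: W)] = [set x; y].
  by rewrite cards2 xy.
apply/setP => z; rewrite !inE; apply/andP/orP => [|[]/eqP ->] //.
case=> zW dz.
have [k Hk] : exists k, forall w, w \in W -> u k z < u k w.
  have [k Hk] := dominantP _ dz z; exists k => w wW.
  rewrite ltn_neqAle Hk ?inE ?wW ?orbT // andbT.
  by apply: contra zW => /eqP /u_inj ->.
(* For every other index the minimum is unchanged by adding [z]. *)
have above l : l != k -> u l (mn l) < u l z.
  move=> lk; rewrite ltnNge; apply/negP => Hl.
  have hz m : (m == l) || (m == k) -> forall w, w \in W -> u m z < u m w.
    case/orP=> /eqP -> w wW; last exact: Hk.
    rewrite ltn_neqAle (leq_trans Hl (mn_min _ _ wW)) andbT.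
    by apply: contra zW => /eqP /u_inj ->.
  (* With [z] below [W] for both [l] and [k], the elements of [W] would all be minimizers for the
     other [|I| - 2] indices, which is one fewer than [|W|]. *)
  have lW w : w \in W -> exists2 m, m \in ~: [set l; k] & mn m = w.
    move=> wW; have [m Hm] := dominantP _ dz w; exists m.
      rewrite !inE; apply/negP => /hz/(_ w wW).
      by rewrite ltnNge Hm // !inE eqxx.
    by apply: mn_eq => // v vW; apply: Hm; rewrite !inE vW orbT.
  have : W \subset mn @: ~: [set l; k].
    by apply/subsetP => w /lW[m Hm <-]; exact: imset_f.
  move/subset_leq_card/leq_trans => /(_ _ (leq_imset_card _ _)).
  have := cardsC [set l; k]; rewrite cards2 lk -cW /= add2n => -[<-].
  by rewrite ltnn.
have zmax m : m = k -> z \in Y m /\ forall t, t \in Y m -> u m t <= u m z.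
  move=> ->; split.
    by rewrite inE; apply/forallP => l; apply/implyP/above.
  move=> t tY; have [l Hl] := dominantP _ dz t.
  have [<-|lk] := eqVneq l k; first by apply: Hl; rewrite !inE eqxx.
  have := leq_trans (YP _ _ tY l lk) (Hl (mn l) _).
  by rewrite ltnn !inE mnW orbT => /(_ isT).
have [ki|ki] := eqVneq k i.
  have [zY zm] := zmax i (esym ki); left; apply/eqP/(@u_inj i)/eqP.
  by rewrite eqn_leq xmax // zm.
have [kj|kj] := eqVneq k j.
  have [zY zm] := zmax j (esym kj); right; apply/eqP/(@u_inj j)/eqP.
  by rewrite eqn_leq ymax // zm.
(* If [k] is neither [i] nor [j], the minimizer of [i] is also that of [j], so [|I| - 2] indices
   would again suffice to reach all of [W]. *)
have : W \subset mn @: ~: [set i; k].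
  apply/subsetP => w wW; have [m Hm] := dominantP _ dz w.
  have mk : m != k.
    apply/eqP => mk; have := Hk w wW.
    by rewrite ltnNge -mk Hm // !inE eqxx.
  have E : mn m = w.
    by apply: mn_eq => // v vW; apply: Hm; rewrite !inE vW orbT.
  have [mi|mi] := eqVneq m i; apply/imsetP.
    by exists j; rewrite ?inE ?negb_or ?ji 1?eq_sym ?kj // -mij -mi.
  by exists m; rewrite ?inE ?negb_or ?mi.
move/subset_leq_card/leq_trans => /(_ _ (leq_imset_card _ _)).
have := cardsC [set i; k]; rewrite cards2 (eq_sym i) ki -cW /= add2n => -[<-].
by rewrite ltnn.
Qed.

(** Double counting of the pairs formed by a dominant set of full size and an element whose removal
    leaves exactly the labels other than [i0]: by [odd_almost_labelled] the fully labelled sets are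
    those in an odd number of pairs, and the right-hand side groups the pairs by the set that is
    left. *)
Lemma odd_labelled_dominant lab (i0 : I) :
  odd #|[set W | [&& dominant W, #|W| == #|I| & lab @: W == setT]]| =
  odd (\sum_(W : {set Z} | (lab @: W == ~: [set i0]) && (#|W|.+1 == #|I|))
         #|[set w | w \notin W & dominant (w |: W)]|).
Proof.
transitivity (odd (\sum_(W | dominant W && (#|W| == #|I|))
    #|[set w in W | lab @: (W :\ w) == ~: [set i0]]|)).
  rewrite -sum1_card (big_morph odd oddD (erefl _)).
  rewrite [RHS](big_morph odd oddD (erefl _)) /=.
  under [RHS]eq_bigr => W /andP[_ /eqP cW] do rewrite odd_almost_labelled//.
  rewrite (eq_bigl (fun W => (dominant W && (#|W| == #|I|)) && (lab @: W == setT))).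
    by rewrite big_mkcondr; apply: eq_bigr => W _; case: ifP.
  by move=> W; rewrite inE andbA.
congr odd.
under eq_bigr do rewrite -sum1_card big_mkcond.
rewrite exchange_big /=.
under [RHS]eq_bigr do rewrite -sum1_card big_mkcond.
rewrite [RHS]exchange_big /=; apply: eq_bigr => w _.
rewrite -!big_mkcondr /=.
rewrite (reindex_onto (fun W => w |: W) (fun W => W :\ w)) /=; last first.
  by move=> W /andP[_]; rewrite inE => /andP[/setD1K].
apply: eq_bigl => W; rewrite !inE eqxx /=.
have [wW|wW] /= := boolP (w \in W).
  rewrite !andbF; apply/negP => /andP[_ /eqP /setP /(_ w)].
  by rewrite !inE wW eqxx.
have -> : (w |: W) :\ w = W by rewrite setU1K.
rewrite eqxx andbT cardsU1 wW add1n.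
by case: dominant; rewrite ?andbF //= andbT andbC.
Qed.

End dominant_sets.

Section scarf.
Context {X I : finType} (u : I -> X -> nat) (c : X -> I).
Hypothesis u_inj : forall i, injective (u i).

Let B := (\sum_i \sum_x u i x).+2.

(* The slack element [inr i] is the smallest one for [i], and is above all of
   [X] for the other indices. *)
Let v (i : I) (z : X + I) : nat :=
  match z with
  | inl x => (u i x).+1
  | inr j => if j == i then 0 else B + enum_rank j
  end.

Let u_lt i x : (u i x).+1 < B.
Proof. by rewrite /B !ltnS (bigD1 i)//= (bigD1 x)//= -addnA leq_addr. Qed.

Let v_inj i : injective (v i).
Proof.
move=> [x|j] [y|k] //=.
- by case=> /u_inj ->.
- by case: ifP => // _ E; have := u_lt i x; rewrite E ltnNge leq_addr.
- by case: ifP => // _ E; have := u_lt i y; rewrite -E ltnNge leq_addr.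
- case: eqP => [->|_]; case: eqP => [->|_] //.
  by move=> /addnI/val_inj/enum_rank_inj ->.
Qed.

Let lab (z : X + I) : I := match z with inl x => c x | inr i => i end.

(** Parity on [X + I]: an almost labelled set has no or two dominant extensions, except the set of
    slack elements other than [i0], whose only extension is by the [u i0]-largest point of [X]. So a
    fully labelled dominant [W] exists; [S] is its part in [X], and [C] the set of indices whose
    slack element is not in [W]. *)
Lemma scarf (x0 : X) (i0 : I) : exists (S : {set X}) (C : {set I}),
  (forall i, i \in C -> exists2 x, x \in S & c x = i) /\
  (forall y, exists2 i, i \in C & forall x, x \in S -> u i y <= u i x).
Proof.
suff [W /and3P[/dominantP dW _ /eqP lW]] : exists W : {set X + I},
    [&& dominant v W, #|W| == #|I| & lab @: W == setT].
  exists [set x | inl x \in W], [set i | inr i \notin W]; split=> [i|y].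
    rewrite inE => iW; have : i \in lab @: W by rewrite lW inE.
    case/imsetP=> -[x xW ->|j jW ij]; first by exists x; rewrite ?inE.
    by rewrite ij jW in iW.
  have [i Hi] := dW (inl y); exists i => [|x].
    by rewrite inE; apply/negP => /Hi /=; rewrite eqxx.
  by rewrite inE => /Hi.
suff : odd #|[set W | [&& dominant v W, #|W| == #|I| & lab @: W == setT]]|.
  case: (set_0Vmem [set W | [&& dominant v W, #|W| == #|I| & lab @: W == setT]]).
    by move=> ->; rewrite cards0.
  by case=> W; rewrite inE => HW _; exists W.
rewrite (odd_labelled_dominant v lab i0).
pose W0 : {set X + I} := inr @: ~: [set i0].
have inj : injective (@inr X I) by move=> ? ? [].
have lW0 : lab @: W0 = ~: [set i0].
  by rewrite /W0 -imset_comp; apply: imset_id.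
have cW0 : #|W0|.+1 = #|I|.
  by rewrite card_imset // cardsC1 prednK //; apply/card_gt0P; exists i0.
rewrite (bigD1 W0) /=; last by rewrite lW0 cW0 !eqxx.
rewrite oddD [X in _ (+) X](_ : _ = false).
  pose x1 := [arg max_(x > x0) u i0 x].
  have Hx1 y : u i0 y <= u i0 x1 by rewrite /x1; case: arg_maxnP => // ? _; exact.
  suff -> : [set w | w \notin W0 & dominant v (w |: W0)] = [set inl x1].
    by rewrite cards1.
  apply/setP => w; rewrite !inE; apply/andP/eqP => [[wW0 /dominantP dw]|->].
    have [i Hi] := dw (inl x1).
    have Hr j : inr j \in w |: W0 -> j != i.
      by apply: contraTneq => ->; apply/negP => /Hi /=; rewrite eqxx.
    have ii0 : i = i0.
      apply/eqP; apply: contraT => ii0; have /eqP[] // : i != i.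
      by apply: Hr; rewrite !inE (mem_imset _ _ inj) !inE ii0 orbT.
    case: w => [x|j] in wW0 dw Hi Hr *; last first.
      have : j != i by apply: Hr; rewrite !inE eqxx.
      by move: wW0; rewrite (mem_imset _ _ inj) !inE negbK ii0 => ->.
    have := Hi (inl x); rewrite !inE eqxx /= ltnS => /(_ isT) xx.
    congr inl; apply: (@u_inj i); apply/eqP.
    by rewrite eqn_leq xx ii0 Hx1.
  split; first by apply/imsetP => -[].
  apply/dominantP => -[y|j].
    exists i0 => z; rewrite !inE => /orP[/eqP -> /=|/imsetP[k]].
      by rewrite ltnS.
    by rewrite !inE => /negPf k0 -> /=; rewrite k0 ltnW // ltn_addr.
  by exists j => z _ /=; rewrite eqxx.
rewrite (big_morph odd oddD (erefl _)) big1 // => W /andP[/andP[/eqP lW /eqP cW] WW0].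
have [x xW] : exists x, inl x \in W.
  apply/existsP; apply: contraT; rewrite negb_exists => /forallP nW.
  case/negP: WW0; apply/eqP/setP => -[x|i]; first rewrite (negPf (nW x)).
    by symmetry; apply/negP => /imsetP[].
  rewrite (mem_imset _ _ inj) -lW; apply/idP/imsetP => [iW|[[x|j]]].
  - by exists (inr i).
  - by rewrite (negPf (nW x)).
  - by move=> jW ->.
have [dW|ndW] := boolP (dominant v W); last first.
  suff -> : [set w | w \notin W & dominant v (w |: W)] = set0 by rewrite cards0.
  apply/setP => w; rewrite !inE; apply/negP => /andP[_].
  by move/negP: ndW; apply: contra_not; exact/dominant_sub/subsetUr.
rewrite card_dominant_extensions //; first by apply/set0Pn; exists (inl x).
(* The slack element of [i] is above the point [inl x] of [W] in every ordering but the one of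
   [i]. *)
move=> i; exists (inr i) => k ki; exists (inl x) => //=.
by rewrite eq_sym (negPf ki) ltn_addr.
Qed.

End scarf.

(** * Scarf's lemma on the lattice points of a simplex *)

Section lattice_simplex.
Context {J : finType}.

Definition lattice_simplex (N : nat) :=
  {x : {ffun J -> 'I_N.+1} | \sum_j x j == N :> nat}.

HB.instance Definition _ N := Finite.on (lattice_simplex N).

(** Let [m] be the vector of coordinate minima over Scarf's set [S]. No lattice point exceeds [m] in
    all coordinates of [C], so the numbers [m i + 1], [i] in [C], add up to more than [N]. A point
    of [S] has total mass [N], hence less than [|J|] in excess of [m] on [C] and outside [C]
    together. *)
Lemma lattice_simplex_labelled (N : nat) (i0 : J)
    (c : {ffun J -> 'I_N.+1} -> J) :
  exists x : {ffun J -> 'I_N.+1}, \sum_j x j = N :> nat /\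
    forall i, x i < #|J| \/
    exists y : {ffun J -> 'I_N.+1},
      [/\ \sum_j y j = N :> nat, c y = i &
         forall j, x j <= y j + #|J| /\ y j <= x j + #|J|].
Proof.
pose X := lattice_simplex N.
(* Ties in the coordinate [i] are broken by the rank of [x]. *)
pose u (i : J) (x : X) := sval x i * #|{: X}| + enum_rank x.
have Xgt0 (x : X) : enum_rank x < #|{: X}| by exact: ltn_ord.
have u_inj i : injective (u i).
  move=> x y; rewrite /u => E; apply: enum_rank_inj; apply: val_inj => /=.
  by have := congr1 (modn^~ #|{: X}|) E; rewrite !modnMDl !modn_small.
have u_lt i (x y : X) : sval x i < sval y i -> u i x < u i y.
  move=> xy; apply: (@leq_trans ((sval x i).+1 * #|{: X}|)).
    by rewrite /u mulSn [ltnRHS]addnC ltn_add2l.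
  by rewrite (leq_trans _ (leq_addr _ _)) // leq_mul2r xy orbT.
have mk (a : J -> nat) : \sum_j a j <= N ->
    exists y : X, forall j, a j <= sval y j.
  move=> aN; pose b j := a j + (j == i0) * (N - \sum_j a j).
  have sb : \sum_j b j = N.
    have s1 : \sum_j (j == i0) = 1.
      by rewrite (bigD1 i0) //= eqxx big1 // => j /negPf ->.
    by rewrite big_split /= -big_distrl /= s1 mul1n subnKC.
  have bN j : b j < N.+1 by rewrite ltnS -sb (bigD1 j) //= leq_addr.
  have Hy : \sum_j [ffun j => Ordinal (bN j)] j == N.
    by under eq_bigr do rewrite ffunE /=; rewrite sb.
  exists (exist (fun x : {ffun J -> 'I_N.+1} => \sum_j x j == N :> nat) _ Hy) => j.
  by rewrite /= ffunE leq_addr.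
have [x0 _] : exists y : X, forall j, 0 <= sval y j by apply: mk; rewrite big1.
have [S [C [hc hd]]] := scarf (fun x => c (sval x)) u_inj x0 i0.
have [i1 i1C _] := hd x0; have [s0 s0S _] := hc _ i1C.
pose m i := sval [arg min_(s < s0 in S) sval s i] i.
have m_min i s : s \in S -> m i <= sval s i.
  by rewrite /m; case: arg_minnP => // t _ H /H.
have m_at i : exists2 s, s \in S & sval s i = m i.
  by rewrite /m; case: arg_minnP => // s sS _; exists s.
have mN : N < \sum_(i in C) (m i).+1.
  rewrite ltnNge big_mkcond /=; apply/negP => /mk[y Hy].
  have [i iC Hi] := hd y; have [s sS smi] := m_at i.
  have := Hy i; rewrite iC -smi => /u_lt.
  by rewrite ltnNge Hi.
rewrite (eq_bigr (fun i => m i + 1)) in mN; last by move=> ? _; rewrite addn1.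
rewrite big_split /= sum1_card in mN.
have CJ : #|C| <= #|J| by exact: max_card.
have hN (s : X) : \sum_j sval s j = N :> nat by apply/eqP; case: s.
have small (s : X) i : s \in S -> i \notin C -> sval s i < #|J|.
  move=> sS iC; rewrite -(ltn_add2l (\sum_(i in C) m i)).
  apply: (@leq_ltn_trans N); last by rewrite (leq_trans mN) // leq_add2l.
  rewrite -[leqRHS](hN s) [leqRHS](bigID (mem C)) /= leq_add //.
    by apply: leq_sum => j jC; exact: m_min.
  by rewrite (bigD1 i) //= leq_addr.
have near (s : X) i : s \in S -> i \in C -> sval s i < m i + #|J|.
  move=> sS iC; have mD : \sum_(j in C) m j = m i + \sum_(j in C | j != i) m j.
    by rewrite (bigD1 i).
  rewrite -(ltn_add2r (\sum_(j in C | j != i) m j)) addnAC -mD.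
  apply: (@leq_ltn_trans N); last by rewrite (leq_trans mN) // leq_add2l.
  rewrite -[leqRHS](hN s) [leqRHS](bigID (mem C)) /= (bigD1 i iC) /=.
  rewrite -addnA leq_add2l (leq_trans _ (leq_addr _ _)) //.
  by apply: leq_sum => j /andP[jC _]; exact: m_min.
have close (s t : X) j : s \in S -> t \in S -> sval s j <= sval t j + #|J|.
  move=> sS tS; have [jC|jC] := boolP (j \in C).
    by rewrite ltnW // (leq_trans (near _ _ sS jC)) // leq_add2r m_min.
  by rewrite (leq_trans (ltnW (small _ _ sS jC))) // leq_addl.
exists (sval s0); split=> // i.
have [iC|iC] := boolP (i \in C); last by left; exact: small.
by right; have [s sS csi] := hc _ iC; exists (sval s); split=> // j; split; apply: close.
Qed.

End lattice_simplex.

From mathcomp Require Import all_classical all_reals all_analysis.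
From mathcomp Require Import measurable_realfun finmap zify lra ring.
Import Order.TTheory GRing.Theory Num.Theory.
Import numFieldNormedType.Exports.
Local Open Scope classical_set_scope.
Local Open Scope ring_scope.

(** * Brouwer's theorem for products of simplices *)

Lemma cvg_sumr {K : numFieldType} {V : normedModType K} {T : Type}
    (F : set_system T) {FF : Filter F} (I : eqType) (s : seq I)
    (f : I -> T -> V) (l : I -> V) :
  (forall i, i \in s -> f i t @[t --> F] --> l i) ->
  \sum_(i <- s) f i t @[t --> F] --> \sum_(i <- s) l i.
Proof.
move=> fl; rewrite big_seq; under eq_cvg do rewrite big_seq.
by apply: cvg_big => //; exact: add_continuous.
Qed.

Section simplex.
Context {R : realType}.

Definition simplex {J : finType} (x : J -> R) : Prop :=
  (forall j, 0 <= x j) /\ \sum_j x j = 1.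

Lemma simplex_le1 {J : finType} (x : J -> R) j : simplex x -> x j <= 1.
Proof.
by move=> [x0 <-]; rewrite (bigD1 j)//= lerDl sumr_ge0.
Qed.

(* Filters on [nat] are enough: fixed points are obtained as limits of sequences
   along an ultrafilter. *)
Definition componentwise_continuous {J : Type} (D : set (J -> R))
    (f : (J -> R) -> J -> R) : Prop :=
  forall (F : set_system nat) (z : nat -> J -> R) (x : J -> R),
    ProperFilter F -> (forall n, D (z n)) -> D x ->
    (forall j, z n j @[n --> F] --> x j) ->
    forall j, f (z n) j @[n --> F] --> f x j.

Lemma simplex_approx_fixpoint {J : finType} (f : (J -> R) -> J -> R) (j0 : J) :
  (forall x, simplex x -> simplex (f x)) ->
  forall n, exists2 a, simplex a & forall i, exists b,
    [/\ simplex b, forall j, `|b j - a j| <= #|J|%:R * n.+1%:R^-1 &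
        a i <= #|J|%:R * n.+1%:R^-1 \/ b i <= f b i].
Proof.
move=> fS n.
(* Barycentric grid of denominator [n + 1]; the numerators range from 0 to [n + 1], hence the type
   ['I_n.+2]. *)
pose pt (y : {ffun J -> 'I_n.+2}) (j : J) : R := (y j)%:R * n.+1%:R^-1.
have n0 : 0 <= n.+1%:R^-1 :> R by rewrite invr_ge0.
have ptS (y : {ffun J -> 'I_n.+2}) : (\sum_j y j = n.+1 :> nat)%N -> simplex (pt y).
  move=> sy; split=> [j|]; first by rewrite mulr_ge0.
  by rewrite -mulr_suml -natr_sum sy divff.
pose c y := odflt j0 [pick i | pt y i <= f (pt y) i].
have cP (y : {ffun J -> 'I_n.+2}) :
    (\sum_j y j = n.+1 :> nat)%N -> pt y (c y) <= f (pt y) (c y).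
  move=> sy; rewrite /c; case: pickP => //= H.
  have : \sum_j f (pt y) j < \sum_j pt y j.
    apply: ltr_sum => [|j _]; last by rewrite ltNge H.
    by apply/hasP; exists j0; rewrite ?mem_index_enum.
  by rewrite (fS _ (ptS _ sy)).2 (ptS _ sy).2 ltxx.
have [x [sx Hx]] := lattice_simplex_labelled j0 c.
exists (pt x); first exact: ptS.
move=> i; have [xi|[y [sy cy Hy]]] := Hx i.
  exists (pt x); split; first exact: ptS.
    by move=> j; rewrite subrr normr0 mulr_ge0.
  by left; rewrite ler_wpM2r// ler_nat ltnW.
exists (pt y); split; [exact: ptS| |by right; rewrite -{1 2}cy; exact: cP].
move=> j; rewrite -mulrBl normrM [ `|_^-1|]ger0_norm// ler_wpM2r//.
have [xy yx] := Hy j; rewrite ler_norml lerBlDl lerBrDl -natrD ler_nat yx andbT.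
by rewrite lerBlDr -natrD ler_nat.
Qed.

(** An ultrafilter finer than [\oo] makes the bounded coordinate sequences converge and decides, for
    each [j], which alternative of the approximate fixed points persists: either [x j <= 0] or
    [x j <= f x j] in the limit. Both give [x j <= f x j], and equal total masses force equality. *)
Theorem brouwer_simplex {J : finType} (f : (J -> R) -> J -> R) (j0 : J) :
  (forall x, simplex x -> simplex (f x)) ->
  componentwise_continuous simplex f ->
  exists2 x, simplex x & forall j, f x j = x j.
Proof.
move=> fS fC.
have [G [GU sG]] := @ultraFilterLemma nat \oo _.
have approx n : exists a, simplex a /\ forall i, exists b, [/\ simplex b,
      forall j, `|b j - a j| <= #|J|%:R * n.+1%:R^-1 &
      a i <= #|J|%:R * n.+1%:R^-1 \/ b i <= f b i].
  by have [a aS Ha] := simplex_approx_fixpoint j0 fS n; exists a.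
have [a Ha] := choice approx.
have aS n : simplex (a n) := (Ha n).1.
have [b' Hb'] := choice (fun ni : nat * J => (Ha ni.1).2 ni.2).
pose b n i := b' (n, i).
have Hb n i := Hb' (n, i).
pose h (n : nat) : R := #|J|%:R * n.+1%:R^-1.
have h0 : h n @[n --> G] --> 0.
  suff H : h n @[n --> \oo] --> 0 by move=> B /H; exact: sG.
  rewrite -[0](mulr0 #|J|%:R).
  by apply: cvgM; [exact: cvg_cst|exact: cvg_harmonic].
have acvg j : exists l : R, a n j @[n --> G] --> l.
  have [|l [_ cll]] := @segment_compact R 0 1 (a n j @[n --> G]) _.
    apply: nearW => n /=; rewrite in_itv /=.
    by rewrite (aS n).1 simplex_le1.
  exists l => B lB.
  have [//|GB] := @in_ultra_setVsetC _ G ((fun n => a n j) @^-1` B) GU.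
  by have [y [/= nBy /nBy]] := cll (~` B) B GB lB.
have [x ax] := choice acvg.
have bx i j : b n i j @[n --> G] --> x j.
  rewrite -[x j]addr0.
  have : a n j + (b n i j - a n j) @[n --> G] --> x j + 0.
    apply: cvgD => //; apply: norm_cvg0.
    apply: (squeeze_cvgr _ (cvg_cst 0) h0); apply: nearW => n.
    by rewrite normr_ge0; have [_ -> _] := Hb n i.
  by apply: cvg_trans; apply: near_eq_cvg; apply: nearW => n; rewrite addrCA subrr addr0.
have xS : simplex x.
  split=> [j|]; first by apply: (cvgr_to_ge (ax j)); apply: nearW => n; exact: (aS n).1.
  have : \sum_j a n j @[n --> G] --> \sum_j x j by apply: cvg_sumr.
  under eq_cvg do rewrite (aS _).2.
  by move=> /(cvg_unique (@norm_hausdorff _ _)); apply; exact: cvg_cst.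
have fbx i j : f (b n i) j @[n --> G] --> f x j.
  by apply: fC => // n; have [] := Hb n i.
exists x => //.
have fx_ge j : x j <= f x j.
  have [GA|GA] := @in_ultra_setVsetC _ G [set n | a n j <= h n] GU.
    apply: (@le_trans _ _ 0); last exact: (fS _ xS).1.
    exact: ler_cvg_to (ax j) h0 GA.
  apply: ler_cvg_to (bx j j) (fbx j j) _; apply: filterS GA => n /=.
  by have [_ _ []] := Hb n j.
have : \sum_j (f x j - x j) = 0 by rewrite sumrB (fS _ xS).2 xS.2 subrr.
move/eqP; rewrite psumr_eq0 => [/allP H j|j _]; last by rewrite subr_ge0.
by apply/eqP; rewrite -subr_eq0; apply: (implyP (H j (mem_index_enum j))).
Qed.

End simplex.

Section product_of_simplices.
Context {R : realType} {I J : finType} (A : I -> {set J}).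

Definition psimplex (z : I -> J -> R) : Prop := forall i,
  [/\ forall j, 0 <= z i j, forall j, j \notin A i -> z i j = 0 &
      \sum_j z i j = 1].

Definition pcontinuous (f : (I -> J -> R) -> I -> J -> R) : Prop :=
  forall (F : set_system nat) (z : nat -> I -> J -> R) (x : I -> J -> R),
    ProperFilter F -> (forall n, psimplex (z n)) -> psimplex x ->
    (forall i j, z n i j @[n --> F] --> x i j) ->
    forall i j, f (z n) i j @[n --> F] --> f x i j.

(* The product, scaled by [#|I|^-1], sits inside the simplex over [I * J]; [rho]
   below maps this simplex onto the product and undoes the scaling. *)
Theorem brouwer_product (q : I -> J -> R) (f : (I -> J -> R) -> I -> J -> R)
    (i0 : I) : psimplex q ->
  (forall z, psimplex z -> psimplex (f z)) -> pcontinuous f ->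
  exists2 z, psimplex z & forall i j, f z i j = z i j.
Proof.
move=> qS fS fC; pose K : R := #|I|%:R^-1.
have I0 : (0 < #|I|)%N by apply/card_gt0P; exists i0.
have K0 : 0 < K by rewrite invr_gt0 ltr0n.
have [j0 _] : exists j : J, True.
  have [//|/forallNP nJ] := pselect (exists j : J, True).
  have [_ _] := qS i0; rewrite big1 => [/eqP|j _]; first by rewrite eq_sym oner_eq0.
  by case: (nJ j).
pose m (z : I * J -> R) i := \sum_(j in A i) z (i, j).
(* Each row is corrected along [q] by its deviation from mass [K] and renormalized: the denominator
   is positive even for a row of mass 0, and a row of mass [K] supported in [A i] is merely divided
   by [K]. *)
pose rho (z : I * J -> R) i j := (if j \in A i then z (i, j) + `|K - m z i| * q i j
  else 0) / (m z i + `|K - m z i|).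
have m0 z i : simplex z -> 0 <= m z i by move=> [z0 _]; apply: sumr_ge0.
have d0 z i : simplex z -> 0 < m z i + `|K - m z i|.
  move=> /(m0 _ i); rewrite le_eqVlt => /orP[/eqP <-|mgt0].
    by rewrite add0r subr0 normr_gt0 gt_eqF.
  by rewrite ltr_wpDr.
have rhoS z : simplex z -> psimplex (rho z).
  move=> zS i; have [q0 qA q1] := qS i; split=> [j|j /negPf jA|].
  - rewrite divr_ge0 ?(ltW (d0 _ _ zS))//; case: ifP => // _.
    by rewrite addr_ge0 ?zS.1// mulr_ge0.
  - by rewrite /rho jA mul0r.
  - rewrite -mulr_suml -big_mkcond /= big_split /= -mulr_sumr.
    have -> : \sum_(j in A i) q i j = 1.
      by rewrite -q1 [RHS](bigID (mem (A i)))/= [X in _ + X]big1 ?addr0.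
    by rewrite mulr1 divff// gt_eqF// d0.
pose g z (ij : I * J) := K * f (rho z) ij.1 ij.2.
have sum_pair (z : I * J -> R) : \sum_ij z ij = \sum_i \sum_j z (i, j).
  by rewrite pair_bigA; apply: eq_bigr => -[].
have gS z : simplex z -> simplex (g z).
  move=> /rhoS/fS rS; split=> [[i j]|].
    by have [r0 _ _] := rS i; rewrite mulr_ge0// ltW.
  rewrite sum_pair; under eq_bigr do rewrite -mulr_sumr.
  under eq_bigr => i _ do have [_ _ ->] := rS i.
  by rewrite sumr_const mulr1 -mulr_natl mulfV// pnatr_eq0 -lt0n.
have gC : componentwise_continuous simplex g.
  move=> F z x FF zS xS zx [i j] /=.
  apply: cvgM; first exact: cvg_cst.
  apply: fC => [n||{}i {}j]; [exact: rhoS|exact: rhoS|].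
  have mC : m (z n) i @[n --> F] --> m x i.
    rewrite /m -big_enum; under eq_cvg do rewrite -big_enum.
    by apply: cvg_sumr.
  have wC : `|K - m (z n) i| @[n --> F] --> `|K - m x i|.
    by apply: cvg_norm; apply: cvgB => //; exact: cvg_cst.
  apply: cvgM; last by apply: cvgV; [rewrite gt_eqF// d0|exact: cvgD].
  rewrite /rho; case: ifP => _; last exact: cvg_cst.
  by apply: cvgD; [exact: zx|apply: cvgM => //; exact: cvg_cst].
have [z zS gz] := brouwer_simplex (i0, j0) gS gC.
have rS := rhoS _ zS; exists (rho z) => // i j.
have fz k l : f (rho z) k l = K^-1 * z (k, l).
  by rewrite -gz /g mulKf// gt_eqF.
have zA k l : l \notin A k -> z (k, l) = 0.
  by have [_ frA _] := fS _ rS k; rewrite -gz /g => /frA -> /=; rewrite mulr0.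
have mK : m z i = K.
  have [_ _ f1] := fS _ rS i; rewrite -[K]mulr1 -f1 mulr_sumr [RHS](bigID (mem (A i)))/=.
  rewrite [X in _ + X]big1 => [|j' /zA zj]; last by rewrite fz zj !mulr0.
  by rewrite addr0; apply: eq_bigr => j' _; rewrite fz mulVKf ?gt_eqF.
rewrite fz /rho mK subrr normr0 mul0r !addr0; case: ifP => [_|/negbT/zA ->].
  by rewrite mulrC.
by rewrite mulr0 mul0r.
Qed.

End product_of_simplices.

(** * The Gibbs variational principle *)

Lemma fsumr_finite {R : realType} {T : choiceType} (F : set T) (f : T -> R) :
  finite_set F -> \sum_(x \in F) f x = \sum_(x <- fset_set F) f x.
Proof. exact: fsbig_finite. Qed.

Section relative_entropy.
Context {R : realType} {n : nat}.
Implicit Types (F : set 'cV[R]_n) (p g c : 'cV[R]_n -> R).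

Definition relative_entropy F p g : R :=
  \sum_(x \in F) p x * (ln (p x) - ln (g x)).

(** For [x > 0] this is [x] times the inequality [ln t <= t - 1] at [t = y / x], strict unless
    [t = 1]; for [x = 0] the expression is just [y]. *)
Lemma xlnx_div_leif (x y : R) : 0 <= x -> 0 < y ->
  0 <= x * (ln x - ln y) - (x - y) ?= iff (x == y).
Proof.
rewrite le_eqVlt => /orP[/eqP <-|x0] y0; apply/leifP.
  by rewrite mul0r sub0r sub0r opprK lt_eqF.
have yx0 : 0 < y / x by rewrite divr_gt0.
have -> : x * (ln x - ln y) - (x - y) = x * (y / x - 1 - ln (y / x)).
  by rewrite ln_div ?posrE//; field; rewrite gt_eqF.
have [->|xy] := eqVneq x y.
  by rewrite divff; [rewrite ln1 !subrr mulr0|rewrite gt_eqF].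
rewrite mulr_gt0// subr_gt0 ltrBrDl.
have l0 : ln (y / x) != 0.
  rewrite ln_eq0//; apply: contra xy => /eqP yx1.
  by rewrite -[y](divfK (lt0r_neq0 x0)) yx1 mul1r.
by have := expR_gt1Dx l0; rewrite lnK.
Qed.

(** The subtracted terms [p x - g x] have sum 0, both masses being 1; they make every summand
    nonnegative. *)
Lemma relative_entropyE F p g : finite_set F -> prob_on F p -> prob_on F g ->
  relative_entropy F p g =
    \sum_(x <- fset_set F) (p x * (ln (p x) - ln (g x)) - (p x - g x)).
Proof.
move=> fF [_ _ p1] [_ _ g1]; rewrite /relative_entropy fsumr_finite//.
by rewrite !sumrB -!fsumr_finite// p1 g1 subrr subr0.
Qed.

Lemma relative_entropy_ge0 F p g : finite_set F ->
  prob_on F p -> prob_on F g -> (forall x, F x -> 0 < g x) ->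
  0 <= relative_entropy F p g.
Proof.
move=> fF pF gF g0; rewrite relative_entropyE// big_seq; apply: sumr_ge0 => x.
rewrite in_fset_set// in_setE => Fx; have [p0 _ _] := pF.
exact: (xlnx_div_leif (p0 x) (g0 x Fx)).1.
Qed.

Lemma relative_entropy_eq0 F p g : finite_set F ->
  prob_on F p -> prob_on F g -> (forall x, F x -> 0 < g x) ->
  relative_entropy F p g = 0 -> p = g.
Proof.
move=> fF pF gF g0; rewrite relative_entropyE// => /eqP.
have [p0 pn _] := pF; have [_ gn _] := gF.
rewrite big_seq psumr_eq0 => [/allP pg|x]; last first.
  rewrite in_fset_set// in_setE => Fx; exact: (xlnx_div_leif (p0 x) (g0 x Fx)).1.
apply/funext => x; have [Fx|nFx] := pselect (F x); last by rewrite pn// gn.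
have xF : x \in fset_set F by rewrite in_fset_set// in_setE.
apply/eqP; rewrite -(xlnx_div_leif (p0 x) (g0 x Fx)).2 eq_sym.
by have /implyP := pg x xF; apply.
Qed.

Definition partition_function F (c : 'cV[R]_n -> R) (eps : R) : R :=
  \sum_(x \in F) expR (- (c x / eps)).

Definition gibbs F c (eps : R) (x : 'cV[R]_n) : R :=
  if `[< F x >] then expR (- (c x / eps)) / partition_function F c eps else 0.

Definition free_energy F c (eps : R) (p : 'cV[R]_n -> R) : R :=
  \sum_(x \in F) p x * c x + eps * entropy F p.

Section gibbs_finite.
Variables (F : set 'cV[R]_n) (c : 'cV[R]_n -> R) (eps : R).
Hypotheses (fF : finite_set F) (F0 : F !=set0) (eps0 : 0 < eps).

Lemma partition_function_gt0 : 0 < partition_function F c eps.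
Proof.
have [x Fx] := F0; rewrite /partition_function fsumr_finite//.
have xF : x \in fset_set F by rewrite in_fset_set// in_setE.
rewrite (perm_big _ (perm_to_rem xF)) big_cons /= ltr_pwDl ?expR_gt0//.
by apply: sumr_ge0 => y _; exact: expR_ge0.
Qed.

Lemma gibbs_gt0 x : F x -> 0 < gibbs F c eps x.
Proof.
by move=> Fx; rewrite /gibbs asboolT// divr_gt0 ?expR_gt0 ?partition_function_gt0.
Qed.

Lemma gibbs_prob : prob_on F (gibbs F c eps).
Proof.
split=> [x|x nFx|].
- have [Fx|nFx] := pselect (F x); first exact/ltW/gibbs_gt0.
  by rewrite /gibbs asboolF.
- by rewrite /gibbs asboolF.
transitivity (\sum_(x \in F) (expR (- (c x / eps)) / partition_function F c eps)).
  by apply: eq_fsbigr => x; rewrite in_setE => Fx; rewrite /gibbs asboolT.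
rewrite fsumr_finite// -mulr_suml -fsumr_finite// divff//.
by rewrite gt_eqF// partition_function_gt0.
Qed.

(** With [Z] the partition function, the Gibbs weight has logarithm [- c x / eps - ln Z]; what is
    not relative entropy is therefore the constant [- eps * ln Z], the minimal free energy. *)
Lemma free_energyE p : prob_on F p -> free_energy F c eps p =
  - eps * ln (partition_function F c eps)
  + eps * relative_entropy F p (gibbs F c eps).
Proof.
move=> [_ _ p1]; rewrite /free_energy /entropy /relative_entropy.
rewrite -[X in X * ln _]mulr1 -p1 !fsumr_finite// !mulr_sumr mulr_suml.
rewrite -!big_split /= big_seq [RHS]big_seq; apply: eq_bigr => x.
rewrite in_fset_set// in_setE => Fx; rewrite /gibbs asboolT//.
rewrite ln_div ?posrE ?expR_gt0 ?partition_function_gt0// expRK.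
by field; rewrite gt_eqF.
Qed.

Lemma relative_entropyxx p : relative_entropy F p p = 0.
Proof. by rewrite /relative_entropy fsbig1// => x _; rewrite subrr mulr0. Qed.

Lemma argmin_free_energy :
  argmin (prob_on F) (free_energy F c eps) = gibbs F c eps.
Proof.
set G := gibbs F c eps; have GF : prob_on F G := gibbs_prob.
have min p : prob_on F p -> free_energy F c eps G <= free_energy F c eps p.
  move=> pF; rewrite !free_energyE// relative_entropyxx lerD2l ler_pM2l//.
  by apply: relative_entropy_ge0 => // x; exact: gibbs_gt0.
(* [get] returns some minimizer; comparing it with [G] shows that its relative entropy is 0, so it
   is [G]. *)
rewrite /argmin; set P := (X in get X).
have [pF /(_ _ GF)] : P (get P) by apply: getPex; exists G; split.
rewrite !free_energyE// relative_entropyxx lerD2l ler_pM2l// => le0.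
apply: (relative_entropy_eq0 fF pF GF) => [x|]; first exact: gibbs_gt0.
by apply/le_anti; rewrite le0 relative_entropy_ge0// => x; exact: gibbs_gt0.
Qed.

End gibbs_finite.

Lemma cvg_gibbs {T : Type} (A : set_system T) {FA : Filter A}
    F (c : T -> 'cV[R]_n -> R) (c0 : 'cV[R]_n -> R) (eps : R) :
  finite_set F -> F !=set0 -> 0 < eps ->
  (forall x, F x -> c t x @[t --> A] --> c0 x) ->
  partition_function F (c t) eps @[t --> A] --> partition_function F c0 eps /\
  forall x, gibbs F (c t) eps x @[t --> A] --> gibbs F c0 eps x.
Proof.
move=> fF F0 eps0 cc.
have ce x : F x -> expR (- (c t x / eps)) @[t --> A] --> expR (- (c0 x / eps)).
  move=> Fx; apply: continuous_cvg; first exact: continuous_expR.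
  by apply: cvgN; apply: cvgM; [exact: cc|exact: cvg_cst].
have cZ : partition_function F (c t) eps @[t --> A] --> partition_function F c0 eps.
  rewrite /partition_function fsumr_finite//.
  under eq_cvg do rewrite fsumr_finite//.
  by apply: cvg_sumr => x; rewrite in_fset_set// in_setE => /ce.
split=> // x; rewrite /gibbs; case: asboolP => Fx; last exact: cvg_cst.
apply: cvgM; first exact: ce.
by apply: cvgV => //; rewrite gt_eqF// partition_function_gt0.
Qed.

End relative_entropy.

(** * Finitely supported measures in the Wasserstein space *)

Section weighted_dirac.
Context {d : measure_display} {Z : measurableType d} {R : realType}.
Variables (W : Z -> R) (W0 : forall z, 0 <= W z) (z0 : Z) (s : seq Z).

(** The construction of [dirac_sum] over an arbitrary measurable space, so that one set of formulas
    serves the measures on R^n and their couplings on the product. *)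
Definition weighted_dirac : set Z -> \bar R :=
  msum (fun i => mscale (NngNum (W0 (nth z0 s i)))
                        (@dirac _ Z (nth z0 s i) R)) (size s).

HB.instance Definition _ := Measure.on weighted_dirac.

Lemma weighted_diracE E : weighted_dirac E = (\sum_(z <- s) W z * \1_E z)%:E.
Proof.
rewrite (big_nth z0) big_mkord -sumEFin /weighted_dirac /msum.
by apply: eq_bigr => i _; rewrite /= /mscale/= diracE indicE -EFinM.
Qed.

Lemma ge0_integral_weighted_dirac (f : Z -> \bar R) :
  measurable_fun setT f -> (forall z, 0 <= f z)%E ->
  (\int[weighted_dirac]_z f z = \sum_(z <- s) (W z)%:E * f z)%E.
Proof.
move=> mf f0; rewrite /weighted_dirac ge0_integral_measure_sum//.
rewrite (big_nth z0) big_mkord; apply: eq_bigr => i _.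
by rewrite ge0_integral_mscale//= integral_dirac// diracT mul1e.
Qed.

Lemma integrable_weighted_dirac (f : Z -> R) :
  measurable_fun setT f -> weighted_dirac.-integrable setT (EFin \o f).
Proof.
move=> mf; have mF : measurable_fun setT (EFin \o f) by exact/measurable_EFinP.
apply/integrableP; split => //.
rewrite ge0_integral_weighted_dirac//; last exact: measurableT_comp.
by apply: lte_sum_pinfty => z _; rewrite /= -EFinM ltry.
Qed.

Lemma integral_weighted_dirac (f : Z -> R) : measurable_fun setT f ->
  (\int[weighted_dirac]_z (f z)%:E = (\sum_(z <- s) W z * f z)%:E)%E.
Proof.
move=> mf; have mF : measurable_fun setT (EFin \o f) by exact/measurable_EFinP.
rewrite integralE !ge0_integral_weighted_dirac//;
  [|exact: measurable_funeneg|exact: measurable_funepos].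
rewrite -!sumEFin.
under eq_bigr do rewrite -/((EFin \o f) _) funeposE -EFin_max -EFinM.
under [X in (_ - X)%E]eq_bigr do
  rewrite -/((EFin \o f) _) funenegE -EFinN -EFin_max -EFinM.
rewrite !sumEFin -EFinB -sumrB; congr EFin; apply: eq_bigr => z _.
rewrite -mulrBr /=; congr (_ * _); case: (leP 0 (f z)) => h.
  by rewrite max_r ?oppr_le0// subr0.
by rewrite max_l ?sub0r ?opprK// oppr_ge0 ltW.
Qed.

End weighted_dirac.

Section dirac_sum_integral.
Context {R : realType} {n : nat} {S : set 'cV[R]_n}.
Hypothesis fS : finite_set S.
Implicit Types p : fprob S.

Lemma sum_finite_support p (f : 'cV[R]_n -> R) :
  \sum_(x <- finite_support 0 S (fprob_val p)) p x * f x =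
  \sum_(x <- fset_set S) p x * f x.
Proof.
have fSp : finite_set (S `&` fprob_val p @^-1` [set~ 0]) by exact: finite_setIl.
rewrite [RHS](bigID (fun x => p x != 0)) /= [X in _ = _ + X]big1 ?addr0; last first.
  by move=> x; rewrite negbK => /eqP ->; rewrite mul0r.
rewrite -[RHS]big_filter; apply: perm_big; apply: uniq_perm.
- exact: finite_support_uniq.
- by rewrite filter_uniq// fset_uniq.
move=> x; rewrite mem_filter in_finite_support// in_fset_set//.
rewrite andbC in_setI; congr andb.
by apply/idP/idP => [|/eqP ?]; rewrite in_setE => //= /eqP.
Qed.

Lemma dirac_sumE p (E : set (borel R n)) :
  dirac_sum p E = (\sum_(x <- fset_set S) p x * \1_E (x : borel R n))%:E.
Proof.
rewrite -sum_finite_support.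
exact: (@weighted_diracE _ (borel R n) R (fprob_val p) (fprob_ge0 p) 0).
Qed.

Lemma integrable_dirac_sum p (f : borel R n -> R) :
  measurable_fun setT f -> (dirac_sum p).-integrable setT (EFin \o f).
Proof. exact: integrable_weighted_dirac. Qed.

Lemma integral_dirac_sum p (f : borel R n -> R) : measurable_fun setT f ->
  (\int[dirac_sum p]_x (f x)%:E = (\sum_(x <- fset_set S) p x * f x)%:E)%E.
Proof. by move=> mf; rewrite -sum_finite_support; exact: integral_weighted_dirac. Qed.

End dirac_sum_integral.

Section borel_measurability.
Context {R : realType} {n : nat}.

Lemma continuous_borel_measurable (f : 'cV[R]_n -> R) :
  continuous f -> measurable_fun setT (f : borel R n -> R).
Proof.
move=> cf; apply: (measurability _ (RGenOpens.measurableE R)).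
move=> _ [_ [a [b ->]] <-]; rewrite setTI; apply: sub_sigma_algebra => /=.
by move/continuousP : cf; apply; exact: interval_open.
Qed.

(** The domain carries the product sigma-algebra, so the norm is written as a maximum of coordinate
    differences, in which continuity is only used on each factor separately. *)
Lemma measurable_norm_sub : measurable_fun setT
  (fun z : borel R n * borel R n => `|(z.1 : 'cV[R]_n) - z.2|).
Proof.
have -> : (fun z : borel R n * borel R n => `|(z.1 : 'cV[R]_n) - z.2|) =
    (fun z => \big[Num.max/0]_ij
      `|(z.1 : 'cV[R]_n) ij.1 ij.2 - (z.2 : 'cV[R]_n) ij.1 ij.2|).
  apply/funext => z; rewrite [LHS]/Num.Def.normr/= mx_normrE.
  by apply: eq_bigr => ij _; rewrite !mxE.
elim: (index_enum _) => [|ij s IH].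
  by under eq_fun do rewrite big_nil; exact: measurable_cst.
under eq_fun do rewrite big_cons.
apply: measurable_maxr => //; apply: measurableT_comp => //.
have mc := continuous_borel_measurable (@coord_continuous R n 1 ij.1 ij.2).
by apply: measurable_funB;
  [apply: (measurableT_comp mc); exact: measurable_fst
  |apply: (measurableT_comp mc); exact: measurable_snd].
Qed.

End borel_measurability.

(** * Bound on the Wasserstein distance by a coupling *)

Section overlap_coupling.
Context {R : realType} {n : nat} {S : set 'cV[R]_n}.
Hypothesis fS : finite_set S.
Variables p p' : fprob S.
Local Notation s := (fset_set S : seq (borel R n)).

Let common (x : borel R n) := Num.min (p x) (p' x).
Let excess (q : fprob S) (x : borel R n) := q x - common x.
Let defect := \sum_(x <- s) excess p x.

(* The common mass stays in place; the rest is coupled independently. *)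
Let weight (z : borel R n * borel R n) : R :=
  (z.1 == z.2)%:R * common z.1 + excess p z.1 * excess p' z.2 / defect.

Let excess_ge0 x : 0 <= excess p x /\ 0 <= excess p' x.
Proof. by rewrite !subr_ge0 !ge_min !lexx orbT. Qed.

Let sum_fprob (q : fprob S) : \sum_(x <- s) q x = 1.
Proof. by have [_ _ <-] := fprob_prop q; rewrite -fsumr_finite. Qed.

Let defect' : defect = \sum_(x <- s) excess p' x.
Proof. by rewrite /defect !sumrB !sum_fprob. Qed.

Let defect_ge0 : 0 <= defect.
Proof. by apply: sumr_ge0 => x _; have [] := excess_ge0 x. Qed.

(** If [defect] is 0, the quotient [defect / defect] is 0 instead of 1, but then all excesses on [s]
    vanish. *)
Let excess_defect q x : q = p \/ q = p' -> x \in s ->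
  excess q x * (defect / defect) = excess q x.
Proof.
move=> qp xs; have [d0|d0] := eqVneq defect 0; last by rewrite divff ?mulr1.
have /eqP : \sum_(y <- s) excess q y = 0 by case: qp => ->; rewrite -?defect'.
rewrite psumr_eq0 => [/allP/(_ x xs)/eqP ->|y _]; first by rewrite mul0r.
by case: qp => ->; have [] := excess_ge0 y.
Qed.

Let weight_ge0 z : 0 <= weight z.
Proof.
have [e1 _] := excess_ge0 z.1; have [_ e2] := excess_ge0 z.2.
rewrite addr_ge0 ?mulr_ge0 ?invr_ge0//.
by rewrite le_min !fprob_ge0.
Qed.

Let pairs := [seq (x, y) | x <- s, y <- s].

Let sum_diag (x : borel R n) (f : borel R n -> R) : x \in s ->
  \sum_(y <- s) (x == y)%:R * f y = f x.
Proof.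
move=> xs; rewrite (bigD1_seq x)//=; last exact: fset_uniq.
rewrite eqxx mul1r big1 ?addr0// => y; rewrite eq_sym => /negPf ->.
by rewrite mul0r.
Qed.

Let sum_weight_fst (f : borel R n -> R) :
  \sum_(z <- pairs) weight z * f z.1 = \sum_(x <- s) p x * f x.
Proof.
rewrite big_allpairs/= big_seq [RHS]big_seq; apply: eq_bigr => x xs.
rewrite -mulr_suml big_split/= (sum_diag (fun=> common x))//.
rewrite -mulr_suml -mulr_sumr -defect' -mulrA excess_defect//; last by left.
by rewrite addrC subrK.
Qed.

Let sum_weight_snd (f : borel R n -> R) :
  \sum_(z <- pairs) weight z * f z.2 = \sum_(x <- s) p' x * f x.
Proof.
rewrite big_allpairs/= exchange_big/= big_seq [RHS]big_seq; apply: eq_bigr => y ys.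
rewrite -mulr_suml big_split/=.
under eq_bigr do rewrite eq_sym.
rewrite (sum_diag common)//.
under [X in _ + X]eq_bigr do rewrite [_ * excess p' y]mulrC.
rewrite -mulr_suml -mulr_sumr -mulrA excess_defect//; last by right.
by rewrite addrC subrK.
Qed.

Let cpl : set (borel R n * borel R n)%type -> \bar R :=
  weighted_dirac weight_ge0 (0, 0) pairs.

HB.instance Definition _ := Measure.on cpl.

Let cpl_setT : cpl setT = 1%E.
Proof.
rewrite /cpl weighted_diracE; congr EFin; rewrite -(sum_fprob p).
under eq_bigr do rewrite indicT.
by rewrite (sum_weight_fst (fun=> 1)); apply: eq_bigr => x _; rewrite mulr1.
Qed.

HB.instance Definition _ := Measure_isProbability.Build _ _ _ cpl cpl_setT.

Let cpl_coupling : coupling (toP1 p) (toP1 p') cpl.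
Proof.
split.
- rewrite /cpl ge0_integral_weighted_dirac//.
  + by apply: lte_sum_pinfty => z _; rewrite -EFinM ltry.
  + have mN := continuous_borel_measurable (@norm_continuous R 'cV[R]_n).
    apply/measurable_EFinP; apply: measurable_maxr.
      by apply: (measurableT_comp mN); exact: measurable_fst.
    by apply: (measurableT_comp mN); exact: measurable_snd.
- move=> E mE; rewrite /= dirac_sumE// /cpl weighted_diracE.
  by rewrite -(sum_weight_fst (\1_E)).
- move=> E mE; rewrite /= dirac_sumE// /cpl weighted_diracE.
  by rewrite -(sum_weight_snd (\1_E)).
Qed.

(** In the coupling [cpl] the diagonal part costs nothing, and the remaining mass, of size [defect],
    moves by at most [C]; each excess is at most [|p x - p' x|]. *)
Lemma d1_toP1_le (C : R) : (forall x y, S x -> S y -> `|x - y| <= C) -> 0 <= C ->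
  (d1 (toP1 p) (toP1 p') <= (C * \sum_(x <- fset_set S) `|p x - p' x|)%:E)%E.
Proof.
move=> hC C0.
apply: (@le_trans _ _ (\int[cpl]_z (`|(z.1 : 'cV[R]_n) - z.2|)%:E)%E).
  by apply: ereal_inf_lbound; exists cpl.
rewrite /cpl ge0_integral_weighted_dirac//; last first.
  by apply/measurable_EFinP; exact: measurable_norm_sub.
under eq_bigr do rewrite -EFinM.
rewrite sumEFin lee_fin big_allpairs/=.
have le_pair x y : x \in s -> y \in s -> weight (x, y) * `|x - y| <=
    C * (excess p x * excess p' y / defect).
  move=> xs ys; rewrite /weight/= mulrDl.
  have -> : (x == y)%:R * common x * `|x - y| = 0.
    by case: eqVneq => [->|_]; rewrite ?subrr ?normr0 ?mulr0// !mul0r.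
  rewrite add0r mulrC ler_wpM2r//.
    by rewrite !mulr_ge0 ?invr_ge0//; [have [] := excess_ge0 x|have [] := excess_ge0 y].
  by move: xs ys; rewrite !in_fset_set// !in_setE; exact: hC.
apply: (@le_trans _ _ (\sum_(x <- s) C * excess p x)).
  rewrite big_seq [leRHS]big_seq; apply: ler_sum => x xs.
  apply: (@le_trans _ _ (\sum_(y <- s) C * (excess p x * excess p' y / defect))).
    by rewrite big_seq [leRHS]big_seq; apply: ler_sum => y ys; exact: le_pair.
  rewrite -mulr_sumr -mulr_suml -mulr_sumr -defect' -mulrA excess_defect//.
  by left.
rewrite -mulr_sumr ler_wpM2l//; apply: ler_sum => x _.
rewrite /excess /common; case: (leP (p x) (p' x)) => h; first by rewrite subrr.
exact: ler_norm.
Qed.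

End overlap_coupling.

Section toP1_continuity.
Context {R : realType} {n : nat} {S : set 'cV[R]_n}.
Hypothesis fS : finite_set S.
Context {T : Type} {A : set_system T} {FA : Filter A}.
Variables (p : T -> fprob S) (p0 : fprob S).
Hypothesis pc : forall x, S x -> p t x @[t --> A] --> p0 x.

Lemma cvg_toP1 : toP1 (p t) @[t --> A] --> toP1 p0.
Proof.
pose C := \sum_(x <- fset_set S) \sum_(y <- fset_set S) `|x - y|.
have C0 : 0 <= C by apply: sumr_ge0 => x _; exact: sumr_ge0.
have hC x y : S x -> S y -> `|x - y| <= C.
  move=> Sx Sy; have xs : x \in fset_set S by rewrite in_fset_set// in_setE.
  have ys : y \in fset_set S by rewrite in_fset_set// in_setE.
  rewrite /C (bigD1_seq x xs (fset_uniq _))/= (bigD1_seq y ys (fset_uniq _))/=.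
  rewrite -addrA lerDl addr_ge0//.
    exact: sumr_ge0.
  by apply: sumr_ge0 => z _; exact: sumr_ge0.
have : C * \sum_(x <- fset_set S) `|p0 x - p t x| @[t --> A] --> 0.
  rewrite [X in _ --> X](_ : _ = C * \sum_(x <- fset_set S) 0); last first.
    by rewrite big1 ?mulr0.
  apply: cvgM; first exact: cvg_cst.
  apply: cvg_sumr => x; rewrite in_fset_set// in_setE => Sx.
  rewrite [X in _ --> X](_ : 0 = `|p0 x - p0 x|); last by rewrite subrr normr0.
  by apply: cvg_norm; apply: cvgB; [exact: cvg_cst|exact: pc].
move=> /cvgrPdist_lt dc B [e /= e0 eB]; have := dc e e0.
apply: filterS => t; rewrite sub0r normrN => dt; apply: eB => /=.
apply: le_lt_trans (d1_toP1_le fS p0 (p t) hC C0) _; rewrite lte_fin.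
exact: le_lt_trans (ler_norm _) dt.
Qed.

(** [P1] carries only a neighbourhood structure, so the convergence is read off a product
    neighbourhood, with constant first component [x]. *)
Lemma cvg_comp_toP1 {X : nbhsType} (D : set (X * P1 R n)) (x : X)
    (l : X -> P1 R n -> R) : ProperFilter (nbhs x) ->
  continuous_on D (fun z => l z.1 z.2) -> (forall mu, D (x, mu)) ->
  (forall B, nbhs x B -> B x) ->
  l x (toP1 (p t)) @[t --> A] --> l x (toP1 p0).
Proof.
move=> Fx lc Dx xB B /(lc _ (Dx (toP1 p0)))[[P Q] /= [xP muQ] PQ].
have : \forall t \near A, Q (toP1 (p t)) by exact: cvg_toP1.
apply: filterS => t /= Qt.
by apply: (PQ (x, toP1 (p t))) => //; split=> //; exact: xB.
Qed.

End toP1_continuity.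

Section toP1_slices.
Context {R : realType} {n : nat} {S : set 'cV[R]_n}.
Hypothesis fS : finite_set S.
Implicit Types p : fprob S.

(** Neighbourhoods being given by [d1]-balls, the point is that [toP1 p] has distance 0 from itself;
    this is [cvg_toP1] for a constant sequence. *)
Lemma nbhs_toP1 p B : nbhs (toP1 p) B -> B (toP1 p).
Proof.
move=> pB; have cp : toP1 p @[_ --> \oo] --> toP1 p.
  by apply: (cvg_toP1 fS (p := fun=> p)) => x _; exact: cvg_cst.
by have [n0 _ /(_ n0 (leqnn _))] := cp B pB.
Qed.

Lemma continuous_slice {X Y : topologicalType} (e : Y -> X)
    (D : set (X * P1 R n)) (l : X -> P1 R n -> R) p :
  continuous e -> (forall y, D (e y, toP1 p)) ->
  continuous_on D (fun z => l z.1 z.2) -> continuous (fun y => l (e y) (toP1 p)).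
Proof.
move=> ec De lc y B /(lc _ (De y))[[P Q] /= [eP pQ] PQ].
have : \forall y' \near y, P (e y') by exact: ec.
apply: filterS => y' Py'.
by apply: (PQ (e y', toP1 p)) => //; split=> //; exact: nbhs_toP1 pQ.
Qed.

End toP1_slices.

(** Continuity in [x] gives measurability, hence integrability for finitely supported measures, so
    the proviso in [monotone] is met and the integrals are finite sums. *)
Lemma monotone_fprob {R : realType} {r q : nat} {S : set 'cV[R]_(r + q)}
    (Psi : 'cV[R]_(r + q) -> P1 R (r + q) -> R) (p p' : fprob S) :
  finite_set S ->
  (forall p : fprob S, continuous (fun x => Psi x (toP1 p))) -> Defs.monotone Psi ->
  0 <= \sum_(x <- fset_set S) (p x - p' x) * (Psi x (toP1 p) - Psi x (toP1 p')).
Proof.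
move=> fS Pc Pm.
have mP : measurable_fun setT
    ((fun x => Psi x (toP1 p) - Psi x (toP1 p')) : borel R (r + q) -> R).
  apply: continuous_borel_measurable => x.
  exact: (@cvgB R R 'cV[R]_(r + q) (nbhs x) _ _ _ _ _ (Pc p x) (Pc p' x)).
have := Pm (toP1 p) (toP1 p') (integrable_dirac_sum p mP) (integrable_dirac_sum p' mP).
rewrite /= !integral_dirac_sum// -EFinB lee_fin -sumrB => H.
by apply: (le_trans H); apply: ler_sum => x _; rewrite -mulrBl.
Qed.

(** * The finite mean field game *)

Section bounded_grids.
Context {R : realType}.

Lemma mx_norm_ge_entry m n (x : 'M[R]_(m, n)) i j : `|x i j| <= `|x|.
Proof.
rewrite [leRHS]/Num.Def.normr/= mx_normrE.
exact: (le_bigmax _ (fun ij => `|x ij.1 ij.2|) (i, j)).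
Qed.

Lemma norm_mulmx_le m n (B : 'M[R]_(m, n)) (a : 'cV[R]_n) :
  `|B *m a| <= (\sum_i \sum_j `|B i j|) * `|a|.
Proof.
have Bge i : \sum_j `|B i j| <= \sum_i \sum_j `|B i j|.
  by rewrite [leRHS](bigD1 i)//= lerDl; apply: sumr_ge0 => *; exact: sumr_ge0.
rewrite [leLHS]/Num.Def.normr/= mx_normrE; apply/bigmax_leP; split.
  by rewrite mulr_ge0//; apply: sumr_ge0 => *; exact: sumr_ge0.
move=> [i j] _ /=; rewrite mxE (le_trans (ler_norm_sum _ _ _))//.
apply: (@le_trans _ _ (\sum_k `|B i k| * `|a|)).
  by apply: ler_sum => k _; rewrite normrM ler_wpM2l// mx_norm_ge_entry.
by rewrite -mulr_suml ler_wpM2r.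
Qed.

Lemma finite_grid_ball n (h C : R) : 0 < h ->
  finite_set [set x : 'cV[R]_n | grid h x /\ `|x| <= C].
Proof.
(* The integer coordinates of such a point lie between [- N] and [N]; they are stored shifted by
   [N]. *)
move=> h0; pose N := Num.bound `|C / h|.
pose f (w : 'cV['I_(N + N).+1]_n) : 'cV[R]_n :=
  h *: \col_i ((w i 0)%:R - N%:R).
apply: (@sub_finite_set _ _ (f @` setT)); last first.
  exact/finite_image/finite_finset.
move=> x /= [[i ->]] xC.
have iN j : (`|i j 0| <= N%:Z).
  have := le_trans (mx_norm_ge_entry _ j 0) xC; rewrite !mxE normrM gtr0_norm//.
  rewrite mulrC -ler_pdivlMr// => iC.
  have : `|(i j 0)%:~R| <= N%:R :> R.
    apply: (le_trans iC); apply: (le_trans (ler_norm _)).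
    exact/ltW/archi_boundP/normr_ge0.
  by rewrite -intr_norm -[N%:R]/(N%:Z%:~R) ler_int.
exists (\col_j inord `|(i j 0 + N%:Z)%R|%N) => //.
congr (h *: _); apply/colP => j; rewrite !mxE inordK; last first.
  by have := iN j; rewrite ltnS; lia.
have /gez0_abs E : 0 <= i j 0 + N%:Z by have := iN j; lia.
have -> : `|(i j 0 + N%:Z)%R|%N%:R = (i j 0 + N%:Z)%:~R :> R by rewrite -[in RHS]E.
by rewrite intrD addrK.
Qed.

End bounded_grids.

Section finite_game.
Context {R : realType} {r q : nat}.
Variables (D : mfg_data R r q) (Cstar Cb CI : R) (Nt Ns : nat).
Variables (beta : 'cV[R]_q -> 'cV[R]_q -> R) (eps : R).
Local Notation T := (horizon D).
Local Notation st := (states D Cstar Cb Nt Ns beta).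
Local Notation S1 := (S1 D Cb Nt Ns).
Local Notation S2 := (S2 D Nt Ns beta).
Local Notation reach := (reach D Cb Nt Ns beta).
Local Notation ybar := (ybar D Nt).
Local Notation alpha := (alpha D Nt).
Local Notation time := (time D Nt).
Local Notation dt := (dt D Nt).
Local Notation dx := (@dx R Ns).
Local Notation space := (mfg_space D Cstar Cb Nt Ns beta).

Hypotheses (hT : 0 < T) (hNt : (0 < Nt)%N) (hNs : (Nt <= Ns)%N).
Hypothesis hord : forall t, 0 <= t <= T -> usubmx (ctrl D t) \in unitmx.
Hypothesis hbeta : Q1_basis dx CI beta.
Hypothesis heps : 0 < eps.
Hypothesis hreach : forall k x, (k < Nt)%N -> st k x -> reach k x !=set0.
Hypothesis hinit : prob_on (st 0) (init_mass D Cstar Cb Nt Ns beta).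

Lemma dx_gt0 : 0 < dx.
Proof. by rewrite invr_gt0 ltr0n (leq_trans hNt). Qed.

Lemma dt_gt0 : 0 < dt.
Proof. by rewrite divr_gt0// ltr0n. Qed.

Lemma time_itv k : (k <= Nt)%N -> 0 <= time k <= T.
Proof.
move=> kN; rewrite mulr_ge0 ?(ltW dt_gt0)//= /Defs.time /Defs.dt mulrCA.
by rewrite -[leRHS]mulr1 ler_wpM2l ?(ltW hT)// ler_pdivrMr ?ltr0n// mul1r ler_nat.
Qed.

(** The upper block of [ctrl] being invertible, [y1] is an affine function of the control
    [alpha k x y1], so the bound on the control confines [y1] to a ball. *)
Lemma finite_S1 k x : (k < Nt)%N -> finite_set (S1 k x).
Proof.
move=> kN; have uB := hord (time_itv (ltnW kN)).
set B := usubmx (ctrl D (time k)) in uB.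
pose a1 := usubmx (drift D (time k) x).
pose K : R := \sum_i \sum_j `|B i j|.
apply: (sub_finite_set _ (@finite_grid_ball R r dx
  (dt * (K * (Cb * (1 + `|x|)) + `|a1|) + `|usubmx x|) dx_gt0)).
move=> y1 [gy1 ay1]; split=> //=.
have -> : y1 = dt *: (B *m alpha k x y1 + a1) + usubmx x.
  rewrite /Defs.alpha mulKVmx// subrK scalerA mulfV ?gt_eqF ?dt_gt0//.
  by rewrite scale1r subrK.
rewrite (le_trans (ler_normD _ _))// lerD2r normrZ gtr0_norm ?dt_gt0//.
rewrite ler_wpM2l ?(ltW dt_gt0)// (le_trans (ler_normD _ _))// lerD2r.
rewrite (le_trans (norm_mulmx_le _ _))// ler_wpM2l//.
by apply: sumr_ge0 => i _; exact: sumr_ge0.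
Qed.

Lemma finite_S2 k x y1 : finite_set (S2 k x y1).
Proof.
apply: (sub_finite_set _ (@finite_grid_ball R q dx
  (CI * dx + `|ybar k x y1|) dx_gt0)).
move=> y2 [gy2 cy2]; split=> //; have [_ _ _ _ bsupp] := hbeta.
have := bsupp _ gy2 _ cy2; rewrite /= distrC => yC.
by rewrite -[y2](subrK (ybar k x y1)) (le_trans (ler_normD _ _))// lerD2r.
Qed.

(** Enumerates [reach k x] by pairs, so that sums over successors become iterated sums. *)
Let successors k x := [seq col_mx y1 y2 | y1 <- fset_set (S1 k x),
                                          y2 <- fset_set (S2 k x y1)].

Let mem_successors k x y : (k < Nt)%N -> reach k x y <-> y \in successors k x.
Proof.
move=> kN; split=> [[y1S y2S]|/allpairsPdep[y1 [y2 []]]].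
  apply/allpairsPdep; exists (usubmx y), (dsubmx y); rewrite vsubmxK.
  rewrite !in_fset_set ?in_setE//; [exact: finite_S2|exact: finite_S1].
rewrite !in_fset_set ?in_setE; [|exact: finite_S2|exact: finite_S1].
by move=> y1S y2S ->; split; rewrite col_mxKu ?col_mxKd.
Qed.

Lemma finite_reach k x : (k < Nt)%N -> finite_set (reach k x).
Proof.
move=> kN; apply: (sub_finite_set _ (finite_seq (successors k x))).
by move=> y /mem_successors; apply.
Qed.

Lemma finite_states k : (k <= Nt)%N -> finite_set (st k).
Proof.
elim: k => [_|k IH kN]; first exact: finite_grid_ball dx_gt0.
apply: bigcup_finite => [|x _]; first exact/IH/ltnW.
exact: finite_reach.
Qed.

Lemma mem_states k x : (k <= Nt)%N -> x \in fset_set (st k) -> st k x.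
Proof. by move=> kN; rewrite in_fset_set ?in_setE//; exact: finite_states. Qed.

Lemma S1_nonempty k x : (k < Nt)%N -> st k x -> S1 k x !=set0.
Proof. by move=> kN /hreach - /(_ kN)[y [y1S _]]; exists (usubmx y). Qed.

Lemma states_nonempty k : (k <= Nt)%N -> st k !=set0.
Proof.
elim: k => [_|k IH kN]; last first.
  by have [x xk] := IH (ltnW kN); have [y yx] := hreach kN xk; exists y, x.
apply/set0P; apply: contraT; rewrite negbK => /eqP st0.
by have [_ _] := hinit; rewrite st0 fsbig_set0 => /eqP; rewrite eq_sym oner_eq0.
Qed.

Lemma interpE k x y1 phi : interp beta (S2 k x y1) phi (ybar k x y1) =
  \sum_(y2 <- fset_set (S2 k x y1)) beta y2 (ybar k x y1) * phi y2.
Proof. by rewrite /interp fsumr_finite//; exact: finite_S2. Qed.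

(** Partition of unity: a grid point outside [S2 k x y1] has a basis function vanishing at
    [ybar k x y1], a set being contained in its closure. *)
Lemma interp1 k x y1 : interp beta (S2 k x y1) (fun=> 1) (ybar k x y1) = 1.
Proof.
have [_ _ _ b1 _] := hbeta; rewrite -[RHS](b1 (ybar k x y1)) /interp.
under eq_fsbigr do rewrite mulr1.
apply: fsbig_widen => [y2 []//|y2 [/= gy2 nS2]].
apply/eqP; apply: contra_notT nS2 => b0; split => //.
exact: subset_closure.
Qed.

Lemma beta_ge0 k x y1 y2 : S2 k x y1 y2 -> 0 <= beta y2 (ybar k x y1).
Proof. by move=> [gy2 _]; have [b0 _ _ _ _] := hbeta; exact: b0. Qed.

Definition stage_cost (M : space) k x (W : 'cV[R]_(r + q) -> R) y1 : R :=
  dt * ell D (time k) (alpha k x y1) x (flow M k)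
  + interp beta (S2 k x y1) (fun y2 => W (col_mx y1 y2)) (ybar k x y1).

(** * Bellman's equation and the forward equation for a given flow *)

Section fixed_flow.
Variable M : space.
Local Notation V := (V eps M).
Local Notation cost k x := (stage_cost M k x (V k.+1)).

Lemma V_terminal x : V Nt x = gT D x (flow M Nt).
Proof. by rewrite /Defs.V subnn. Qed.

(** [bellman] is, by conversion, the free energy of the stage cost. *)
Lemma bellman_policy k x : (k < Nt)%N -> st k x ->
  policy eps M k x = gibbs (S1 k x) (cost k x) eps.
Proof.
move=> kN xk; apply: argmin_free_energy => //; [exact: finite_S1|].
exact: S1_nonempty.
Qed.

Lemma V_bellman k x : (k < Nt)%N ->
  V k x = bellman eps M k x (V k.+1) (policy eps M k x).
Proof.
move=> kN; have E : (Nt - k = (Nt - k.+1).+1)%N by rewrite subnSK.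
by rewrite {1}/Defs.V E /= -E subKn ?(ltnW kN).
Qed.

(* The gap in the dynamic programming principle is a relative entropy. *)
Lemma bellman_gap k x p : (k < Nt)%N -> st k x -> prob_on (S1 k x) p ->
  bellman eps M k x (V k.+1) p =
  V k x + eps * relative_entropy (S1 k x) p (policy eps M k x).
Proof.
move=> kN xk pS; have fS1 := finite_S1 x kN; have S10 := S1_nonempty kN xk.
rewrite V_bellman// bellman_policy//.
have free p' : bellman eps M k x (V k.+1) p' =
  free_energy (S1 k x) (cost k x) eps p' by [].
rewrite !free !free_energyE//; last exact: gibbs_prob.
by rewrite relative_entropyxx mulr0 addr0.
Qed.

(** A closed form of the minimum, from which continuity in the flow is read off. *)
Lemma V_partition k x : (k < Nt)%N -> st k x ->
  V k x = - eps * ln (partition_function (S1 k x) (cost k x) eps).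
Proof.
move=> kN xk; have fS1 := finite_S1 x kN; have S10 := S1_nonempty kN xk.
rewrite V_bellman// bellman_policy//.
rewrite -[LHS]/(free_energy (S1 k x) (cost k x) eps _) free_energyE//.
  by rewrite relative_entropyxx mulr0 addr0.
exact: gibbs_prob.
Qed.

Lemma policy_prob k x : (k < Nt)%N -> st k x ->
  prob_on (S1 k x) (policy eps M k x).
Proof.
move=> kN xk; rewrite bellman_policy//; apply: gibbs_prob => //.
  exact: finite_S1.
exact: S1_nonempty.
Qed.

Lemma policy_gt0 k x y1 : (k < Nt)%N -> st k x -> S1 k x y1 ->
  0 < policy eps M k x y1.
Proof.
move=> kN xk; rewrite bellman_policy//; apply: gibbs_gt0 => //.
  exact: finite_S1.
exact: S1_nonempty.
Qed.

(** The kernel from [x] vanishes off [reach k x]; summing there over [y2] first produces the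
    interpolation at [ybar]. *)
Lemma sum_transition k x phi : (k < Nt)%N -> st k x ->
  \sum_(y <- fset_set (st k.+1)) transition eps M k x y * phi y =
  \sum_(y1 <- fset_set (S1 k x)) policy eps M k x y1 *
    interp beta (S2 k x y1) (fun y2 => phi (col_mx y1 y2)) (ybar k x y1).
Proof.
move=> kN xk; have fr := finite_reach x kN; have fs := finite_states kN.
transitivity (\sum_(y <- fset_set (reach k x)) transition eps M k x y * phi y).
  rewrite -!fsumr_finite//; symmetry; apply: fsbig_widen => [y yx|y [_ nyx]].
    by exists x.
  by rewrite /transition /= asboolF// mul0r.
transitivity (\sum_(y <- successors k x) transition eps M k x y * phi y).
  apply: perm_big; apply: uniq_perm; first exact: fset_uniq.
    apply: allpairs_uniq_dep => [||[y1 y2] [z1 z2] _ _ /= /eq_col_mx[-> ->]//].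
      exact: fset_uniq.
    by move=> y1 _; exact: fset_uniq.
  move=> y; rewrite in_fset_set//; apply/idP/idP; rewrite in_setE.
    by move/mem_successors; apply.
  by move=> ys; apply/mem_successors.
rewrite big_allpairs_dep/= big_seq [RHS]big_seq; apply: eq_bigr => y1.
rewrite in_fset_set ?in_setE; last exact: finite_S1.
move=> y1S; rewrite interpE mulr_sumr big_seq [RHS]big_seq; apply: eq_bigr => y2.
rewrite in_fset_set ?in_setE; last exact: finite_S2.
by move=> y2S; rewrite /transition asboolT /Defs.reach/= ?col_mxKu ?col_mxKd// mulrA.
Qed.

Lemma transition_ge0 k x y : (k < Nt)%N -> st k x -> 0 <= transition eps M k x y.
Proof.
move=> kN xk; rewrite /transition; case: asboolP => // -[y1S y2S].
by rewrite mulr_ge0 ?beta_ge0// ltW// policy_gt0.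
Qed.

Lemma best_responseS k y : (k < Nt)%N -> best_response eps M k.+1 y =
  \sum_(x <- fset_set (st k)) transition eps M k x y * best_response eps M k x.
Proof. by move=> kN /=; rewrite fsumr_finite//; exact/finite_states/ltnW. Qed.

(** Duality: the forward equation is the adjoint of the averaging of [phi] that occurs in Bellman's
    equation. *)
Lemma sum_best_response k phi : (k < Nt)%N ->
  \sum_(y <- fset_set (st k.+1)) best_response eps M k.+1 y * phi y =
  \sum_(x <- fset_set (st k)) best_response eps M k x *
    \sum_(y1 <- fset_set (S1 k x)) policy eps M k x y1 *
      interp beta (S2 k x y1) (fun y2 => phi (col_mx y1 y2)) (ybar k x y1).
Proof.
move=> kN; under eq_bigr do rewrite best_responseS// mulr_suml.
rewrite exchange_big/= big_seq [RHS]big_seq; apply: eq_bigr => x.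
rewrite in_fset_set ?in_setE; last exact/finite_states/ltnW.
move=> xk; rewrite -sum_transition// mulr_sumr.
by apply: eq_bigr => y _; rewrite -mulrA mulrCA mulrA.
Qed.

Lemma best_response_prob k : (k <= Nt)%N ->
  prob_on (st k) (best_response eps M k).
Proof.
elim: k => [//|k IH kN]; have [b0 bn b1] := IH (ltnW kN).
have fk := finite_states (ltnW kN); have fk1 := finite_states kN.
split=> [y|y ny|].
- rewrite best_responseS// big_seq; apply: sumr_ge0 => x.
  by rewrite in_fset_set// in_setE => xk; rewrite mulr_ge0// transition_ge0.
- rewrite best_responseS// big_seq big1// => x; rewrite in_fset_set// in_setE => xk.
  by rewrite /transition asboolF ?mul0r// => yx; apply: ny; exists x.
rewrite fsumr_finite//.
(* Testing against the constant 1 gives conservation of mass. *)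
have /= := @sum_best_response k (fun=> 1) kN; under eq_bigr do rewrite mulr1.
move=> ->; transitivity (\sum_(x <- fset_set (st k)) best_response eps M k x).
  rewrite big_seq [RHS]big_seq; apply: eq_bigr => x.
  rewrite in_fset_set// in_setE => xk; rewrite -[RHS]mulr1; congr (_ * _).
  have [_ _ p1] := policy_prob kN xk; have fS1 := finite_S1 x kN.
  transitivity (\sum_(y1 <- fset_set (S1 k x)) policy eps M k x y1).
    by apply: eq_bigr => y1 _; rewrite -[RHS]mulr1; congr (_ * _); exact: interp1.
  by rewrite -fsumr_finite.
by rewrite -fsumr_finite.
Qed.

End fixed_flow.

(** * Continuity of the best response in the flow *)

Section continuity.
Hypothesis hell : running_continuous D (ell D).
Hypothesis hg : continuous_on [set: 'cV[R]_(r + q) * P1 R (r + q)]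
  (fun z => gT D z.1 z.2).
Context {X : Type} {A : set_system X} {FA : Filter A}.
Variables (M : X -> space) (M0 : space).
Hypothesis hM : forall (k : 'I_Nt.+1) x, st k x -> M t k x @[t --> A] --> M0 k x.

Lemma cvg_ell k a x : (k <= Nt)%N ->
  ell D (time k) a x (flow (M t) k) @[t --> A] --> ell D (time k) a x (flow M0 k).
Proof.
move=> kN; have fk : finite_set (st (inord k : 'I_Nt.+1)).
  by apply: finite_states; rewrite -ltnS.
apply: (cvg_comp_toP1 fk (hM (k := inord k)) (x := (time k, a, x))
  (l := fun y mu => ell D y.1.1 y.1.2 y.2 mu)
  (D := [set z | 0 <= z.1.1.1 <= T])) => //.
- by move=> mu; exact: time_itv.
- by move=> B; exact: nbhs_singleton.
Qed.

Lemma cvg_stage_cost k x y1 (W : X -> 'cV[R]_(r + q) -> R) W0 :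
  (k < Nt)%N -> st k x -> S1 k x y1 ->
  (forall y, st k.+1 y -> W t y @[t --> A] --> W0 y) ->
  stage_cost (M t) k x (W t) y1 @[t --> A] --> stage_cost M0 k x W0 y1.
Proof.
move=> kN xk y1S Wc; apply: cvgD.
  by apply: cvgM; [exact: cvg_cst|exact/cvg_ell/ltnW].
rewrite interpE; under eq_cvg do rewrite interpE.
apply: cvg_sumr => y2; rewrite in_fset_set ?in_setE; last exact: finite_S2.
move=> y2S; apply: cvgM; first exact: cvg_cst.
by apply: Wc; exists x; [exact: xk|split; rewrite col_mxKu ?col_mxKd].
Qed.

Lemma cvg_V k x : (k <= Nt)%N -> st k x ->
  V eps (M t) k x @[t --> A] --> V eps M0 k x.
Proof.
move=> kN; rewrite -(subKn kN); move: (Nt - k)%N (leq_subr k Nt) => {k kN} j.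
elim: j x => [|j IH] x jN xk.
  rewrite subn0 V_terminal; under eq_cvg do rewrite V_terminal.
  have fN : finite_set (st (inord Nt : 'I_Nt.+1)).
    by apply: finite_states; rewrite -ltnS.
  apply: (cvg_comp_toP1 fN (hM (k := inord Nt)) (l := gT D) (D := setT)) => //.
  by move=> B; exact: nbhs_singleton.
have kN : (Nt - j.+1 < Nt)%N by rewrite ltn_subrL.
have kE : (Nt - j.+1).+1 = (Nt - j)%N by rewrite subnSK.
rewrite V_partition//; under eq_cvg do rewrite V_partition//.
apply: cvgM; first exact: cvg_cst.
have costc y1 : S1 (Nt - j.+1) x y1 ->
    stage_cost (M t) (Nt - j.+1) x (V eps (M t) (Nt - j.+1).+1) y1 @[t --> A] -->
    stage_cost M0 (Nt - j.+1) x (V eps M0 (Nt - j.+1).+1) y1.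
  move=> y1S; apply: (cvg_stage_cost kN xk y1S) => y; rewrite kE => yS.
  exact/IH/yS/ltnW.
have [Zc _] := cvg_gibbs (finite_S1 x kN) (S1_nonempty kN xk) heps costc.
apply: (continuous_cvg _ _ Zc); apply: continuous_ln.
by apply: partition_function_gt0; [exact: finite_S1|exact: S1_nonempty].
Qed.

Lemma cvg_policy k x y1 : (k < Nt)%N -> st k x ->
  policy eps (M t) k x y1 @[t --> A] --> policy eps M0 k x y1.
Proof.
move=> kN xk; rewrite bellman_policy//; under eq_cvg do rewrite bellman_policy//.
have [_] := cvg_gibbs (finite_S1 x kN) (S1_nonempty kN xk) heps
  (fun z zS => cvg_stage_cost kN xk zS (fun y yS => cvg_V kN yS)); exact.
Qed.

Lemma cvg_best_response k y : (k <= Nt)%N ->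
  best_response eps (M t) k y @[t --> A] --> best_response eps M0 k y.
Proof.
elim: k y => [|k IH] y kN; first exact: cvg_cst.
rewrite best_responseS//; under eq_cvg do rewrite best_responseS//.
apply: cvg_sumr => x; rewrite in_fset_set ?in_setE; last exact/finite_states/ltnW.
move=> xk; apply: cvgM; last exact/IH/ltnW.
rewrite /transition; case: asboolP => _; last exact: cvg_cst.
by apply: cvgM; [exact: cvg_policy|exact: cvg_cst].
Qed.

End continuity.

(** * Existence of an equilibrium *)

Section existence.
Hypothesis hell : running_continuous D (ell D).
Hypothesis hg : continuous_on [set: 'cV[R]_(r + q) * P1 R (r + q)]
  (fun z => gT D z.1 z.2).

(** The state spaces vary with the time step; embedding them in one finite set puts the flows into
    the form required by [brouwer_product], with the states of each step recorded by [A]. *)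
Let all_states := \bigcup_(k in `I_Nt.+1) st k.

Let finite_all_states : finite_set all_states.
Proof. by apply: bigcup_finite => [|k kN]; [exact: finite_II|exact: finite_states]. Qed.

Let U : {fset 'cV[R]_(r + q)} := fset_set all_states.

Let mem_U (k : 'I_Nt.+1) x : st k x -> x \in U.
Proof. by move=> xk; rewrite in_fset_set// in_setE; exists k => //; exact: ltn_ord. Qed.

Let sum_U (k : 'I_Nt.+1) (g : 'cV[R]_(r + q) -> R) :
  (forall x, ~ st k x -> g x = 0) -> \sum_(x \in st k) g x = \sum_(u : U) g (val u).
Proof.
move=> g0; rewrite -(big_seq_fsetE _ _ xpredT g)/= -fsumr_finite//.
by apply: fsbig_widen => [x xk|x [_ /g0]//]; exists k => //; exact: ltn_ord.
Qed.

Let extend (z : 'I_Nt.+1 -> U -> R) k x : R := if insub x is Some u then z k u else 0.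

Let extend_val z k u : extend z k (val u) = z k u.
Proof. by rewrite /extend valK. Qed.

Let A (k : 'I_Nt.+1) : {set U} := [set u | `[< st k (val u) >]]%SET.

Let AP (k : 'I_Nt.+1) u : reflect (st k (val u)) (u \in A k).
Proof. by rewrite finset.inE; exact: asboolP. Qed.

Let extend_prob z (k : 'I_Nt.+1) : psimplex A z -> prob_on (st k) (extend z k).
Proof.
move=> /(_ k)[z0 zA z1]; have ext0 x : ~ st k x -> extend z k x = 0.
  by rewrite /extend; case: insubP => // u _ <- /AP/zA.
split=> [x||] //; first by rewrite /extend; case: insubP.
by rewrite sum_U//; under eq_bigr do rewrite extend_val.
Qed.

Let states_prob (k : 'I_Nt.+1) : fprob (st k).
Proof.
have kN : (k <= Nt)%N by rewrite -ltnS.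
have [x0 x0k] := cid (states_nonempty kN).
apply: (@FProb _ _ _ (fun x => (x == x0)%:R)); split=> [x|x nxk|].
- exact: ler0n.
- by case: eqP => // xx0; case: nxk; rewrite xx0.
have fk := finite_states kN; rewrite fsumr_finite//.
have xk : x0 \in fset_set (st k) by rewrite in_fset_set// in_setE.
rewrite (bigD1_seq x0 xk (fset_uniq _))/= eqxx big1 ?addr0// => x /negPf ->.
by [].
Qed.

(* The value [states_prob] off the product of simplices is irrelevant. *)
Let space_of z : space := fun k =>
  match pselect (prob_on (st k) (extend z k)) with
  | left zP => FProb zP
  | right _ => states_prob k
  end.

Let space_ofE z k x : psimplex A z -> space_of z k x = extend z k x.
Proof. by move=> zS; rewrite /space_of; case: pselect => // -[]; exact: extend_prob. Qed.

Lemma exists_equilibrium : exists M : space, equilibrium eps M.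
Proof.
pose f z (k : 'I_Nt.+1) (u : U) := best_response eps (space_of z) k (val u).
have psimplexP (g : 'I_Nt.+1 -> 'cV[R]_(r + q) -> R) :
    (forall k : 'I_Nt.+1, prob_on (st k) (g k)) -> psimplex A (fun k u => g k (val u)).
  move=> gP k; have [g0 gn g1] := gP k; split=> [u|u /AP/gn|] //.
  by rewrite -g1 sum_U.
have brP (M : space) (k : 'I_Nt.+1) : prob_on (st k) (best_response eps M k).
  have kN : (k <= Nt)%N by rewrite -ltnS.
  exact: (best_response_prob M kN).
have qS := psimplexP _ (fun k => fprob_prop (states_prob k)).
have fS z : psimplex A z -> psimplex A (f z).
  by move=> _; exact: psimplexP (fun k => best_response eps (space_of z) k) (brP _).
have fC : pcontinuous A f.
  move=> F z x FF zS xS zx k u.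
  apply: cvg_best_response; rewrite -1?ltnS// => l y yl.
  rewrite space_ofE//; under eq_cvg do rewrite space_ofE//.
  by rewrite /extend; case: insubP => [v _ _|_]; [exact: zx|exact: cvg_cst].
have [z zS fz] := brouwer_product ord0 qS fS fC.
exists (space_of z) => k x xk; rewrite space_ofE//.
have /(_ xk) xU := @mem_U k x.
by rewrite -[x]/(val [` xU]%fset) extend_val -fz.
Qed.

End existence.

(** * Uniqueness under monotonicity *)

Section uniqueness.
Variables (l0 : R -> 'cV[R]_r -> 'cV[R]_(r + q) -> R).
Variables (f : R -> 'cV[R]_(r + q) -> P1 R (r + q) -> R).
Hypothesis hl : forall t a x mu, 0 <= t <= T ->
  ell D t a x mu = l0 t a x + f t x mu.
Hypothesis hfc : continuous_on
  [set z : R * 'cV[R]_(r + q) * P1 R (r + q) | 0 <= z.1.1 <= T]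
  (fun z => f z.1.1 z.1.2 z.2).
Hypothesis hfm : forall t, 0 <= t <= T -> Defs.monotone (f t).
Hypothesis hg : continuous_on [set: 'cV[R]_(r + q) * P1 R (r + q)]
  (fun z => gT D z.1 z.2).
Hypothesis hgm : Defs.monotone (gT D).

Lemma best_response0 (M M' : space) : best_response eps M 0 = best_response eps M' 0.
Proof. by []. Qed.

(** Times [eps], this is the mean loss at step [k], in the game with flow [M'], of a population
    distributed as the best response to [M] and using its policy. *)
Definition policy_gap (M M' : space) k : R :=
  \sum_(x <- fset_set (st k)) best_response eps M k x *
    relative_entropy (S1 k x) (policy eps M k x) (policy eps M' k x).

Lemma relative_entropy_policy_ge0 (M M' : space) k x : (k < Nt)%N -> st k x ->
  0 <= relative_entropy (S1 k x) (policy eps M k x) (policy eps M' k x).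
Proof.
move=> kN xk; apply: relative_entropy_ge0; [exact: finite_S1|exact: policy_prob..|].
by move=> y1; exact: policy_gt0.
Qed.

Lemma policy_gap_ge0 (M M' : space) k : (k < Nt)%N -> 0 <= policy_gap M M' k.
Proof.
move=> kN; rewrite /policy_gap big_seq; apply: sumr_ge0 => x.
rewrite in_fset_set ?in_setE => [xk|]; last exact/finite_states/ltnW.
rewrite mulr_ge0 ?relative_entropy_policy_ge0//.
by have [] := best_response_prob M (ltnW kN).
Qed.

(** Both Bellman equations are evaluated at the policy of [M], which is optimal for [M] and loses
    [eps] times a relative entropy for [M']. The entropy and the [l0] terms then cancel, and only
    the difference of the [f] terms remains. *)
Lemma value_difference_step (M M' : space) k : (k < Nt)%N ->
  \sum_(y <- fset_set (st k.+1))
    best_response eps M k.+1 y * (V eps M k.+1 y - V eps M' k.+1 y) =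
  \sum_(x <- fset_set (st k))
    best_response eps M k x * (V eps M k x - V eps M' k x)
  - dt * \sum_(x <- fset_set (st k))
    best_response eps M k x * (f (time k) x (flow M k) - f (time k) x (flow M' k))
  - eps * policy_gap M M' k.
Proof.
move=> kN; rewrite sum_best_response// /policy_gap !mulr_sumr -!sumrB.
rewrite big_seq [RHS]big_seq; apply: eq_bigr => x.
rewrite in_fset_set ?in_setE => [xk|]; last exact/finite_states/ltnW.
have fS1 := finite_S1 x kN; have pP := policy_prob M kN xk.
set p := policy eps M k x in pP *; set p' := policy eps M' k x.
(* Bellman's identity solved for the mean of the next value under [p]; [e] is the relative entropy
   of [p] with respect to the policy for [N]. *)
pose E (N : space) (e : R) : R := V eps N k x + eps * e
  - eps * entropy (S1 k x) p
  - dt * (\sum_(y1 <- fset_set (S1 k x)) p y1 * l0 (time k) (alpha k x y1) x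
          + f (time k) x (flow N k)).
have gap (N : space) : \sum_(y1 <- fset_set (S1 k x)) p y1 *
    interp beta (S2 k x y1) (fun y2 => V eps N k.+1 (col_mx y1 y2)) (ybar k x y1) =
  E N (relative_entropy (S1 k x) p (policy eps N k x)).
  rewrite /E -bellman_gap// /bellman addrK fsumr_finite//.
  apply/eqP; rewrite eq_sym subr_eq; apply/eqP.
  have p1 : \sum_(y1 <- fset_set (S1 k x)) p y1 = 1.
    by have [_ _] := pP; rewrite fsumr_finite.
  rewrite -[f _ _ _]mul1r -p1 mulr_suml -big_split mulr_sumr -big_split /=.
  by apply: eq_bigr => y1 _; rewrite hl ?(time_itv (ltnW kN))//; ring.
have RE0 : relative_entropy (S1 k x) p (policy eps M k x) = 0.
  exact: relative_entropyxx.
have -> : \sum_(y1 <- fset_set (S1 k x)) p y1 *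
    interp beta (S2 k x y1) (fun y2 => V eps M k.+1 (col_mx y1 y2)
      - V eps M' k.+1 (col_mx y1 y2)) (ybar k x y1) =
  E M 0 - E M' (relative_entropy (S1 k x) p p').
  transitivity (\sum_(y1 <- fset_set (S1 k x))
    (p y1 * interp beta (S2 k x y1)
       (fun y2 => V eps M k.+1 (col_mx y1 y2)) (ybar k x y1)
     - p y1 * interp beta (S2 k x y1)
       (fun y2 => V eps M' k.+1 (col_mx y1 y2)) (ybar k x y1))).
    apply: eq_bigr => y1 _; rewrite !interpE -mulrBr -sumrB.
    by congr (_ * _); apply: eq_bigr => y2 _; rewrite mulrBr.
  by rewrite sumrB; congr (_ - _); [exact: etrans (gap M) (congr1 (E M) RE0)|exact: gap].
rewrite /E.
move: (best_response _ _ _ _) (V eps M k x) (V eps M' k x) (entropy _ _)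
  (relative_entropy _ _ _) (\sum_(y1 <- _) _) (f _ _ (flow M k)) (f _ _ (flow M' k)).
by move=> b v v' e re L a a'; ring.
Qed.

Section two_equilibria.
Variables M M' : space.
Hypotheses (hM : equilibrium eps M) (hM' : equilibrium eps M').

Let br_flow (N : space) k x : (k <= Nt)%N -> equilibrium eps N ->
  st k x -> best_response eps N k x = N (inord k) x.
Proof.
by move=> kN eN xk; rewrite (eN (inord k)) inordK.
Qed.

(* The Lasry-Lions pairing of the difference of the flows with the difference of
   the values: it vanishes at time 0, is nonnegative at the final time, and is
   nonincreasing because of the monotonicity of [f]. *)
Let gain k : R := \sum_(x <- fset_set (st k))
  (best_response eps M k x - best_response eps M' k x)
  * (V eps M k x - V eps M' k x).

Let monotone_flow k (Psi : 'cV[R]_(r + q) -> P1 R (r + q) -> R) :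
  (k <= Nt)%N ->
  (forall p : fprob (st (inord k : 'I_Nt.+1)), continuous (fun x => Psi x (toP1 p))) ->
  Defs.monotone Psi ->
  0 <= \sum_(x <- fset_set (st k))
    (best_response eps M k x - best_response eps M' k x)
    * (Psi x (flow M k) - Psi x (flow M' k)).
Proof.
move=> kN Pc Pm.
have fk : finite_set (st (inord k : 'I_Nt.+1)) by apply: finite_states; rewrite -ltnS.
apply: (le_trans (monotone_fprob (M (inord k)) (M' (inord k)) fk Pc Pm)).
have -> : fset_set (st (inord k : 'I_Nt.+1)) = fset_set (st k) by rewrite inordK.
rewrite big_seq [leRHS]big_seq; apply: ler_sum => x.
rewrite in_fset_set ?in_setE => [xk|]; last exact: finite_states.
by rewrite !br_flow.
Qed.

(** The sum of [value_difference_step] for [M, M'] and for [M', M]: the best responses being the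
    flows themselves at equilibrium, the [f] terms form the pairing that monotonicity makes
    nonnegative. *)
Let gain_step k : (k < Nt)%N ->
  gain k.+1 <= gain k - eps * (policy_gap M M' k + policy_gap M' M k).
Proof.
move=> kN; have sE j : gain j =
    \sum_(x <- fset_set (st j)) best_response eps M j x * (V eps M j x - V eps M' j x)
  + \sum_(x <- fset_set (st j)) best_response eps M' j x * (V eps M' j x - V eps M j x).
  rewrite /gain -big_split; apply: eq_bigr => x _ /=.
  move: (best_response _ M _ _) (best_response _ M' _ _) (V _ M _ _) (V _ M' _ _).
  by move=> b b' v v'; ring.
have fmono : 0 <= dt * \sum_(x <- fset_set (st k))
    best_response eps M k x * (f (time k) x (flow M k) - f (time k) x (flow M' k))
  + dt * \sum_(x <- fset_set (st k))
    best_response eps M' k x * (f (time k) x (flow M' k) - f (time k) x (flow M k)).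
  rewrite -mulrDr mulr_ge0 ?(ltW dt_gt0)// -big_split /=.
  have fc (p : fprob (st (inord k : 'I_Nt.+1))) :
      continuous (fun x => f (time k) x (toP1 p)).
    have fk : finite_set (st (inord k : 'I_Nt.+1)).
      by apply: finite_states; rewrite -ltnS.
    apply: (continuous_slice fk (e := fun x => (time k, x))
      (l := fun y mu => f y.1 y.2 mu) (D := [set z | 0 <= z.1.1 <= T])) => //.
    - move=> x B [[P Q] /= [tP xQ] PQ].
      have : \forall y \near x, Q y by [].
      apply: filterS => y Qy; apply: (PQ (time k, y)); split=> //=.
      exact: nbhs_singleton.
    - by move=> x; exact: time_itv (ltnW kN).
  apply: (le_trans (monotone_flow (ltnW kN) fc (hfm (time_itv (ltnW kN))))).
  apply: ler_sum => x _; rewrite le_eqVlt; apply/orP; left; apply/eqP.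
  move: (best_response _ M _ _) (best_response _ M' _ _)
    (f _ _ (flow M k)) (f _ _ (flow M' k)).
  by move=> b b' a a'; ring.
have step (g1 g0 X1 Y1 X0 Y0 F F' P P' : R) : g1 = X1 + Y1 ->
    X1 = X0 - F - eps * P -> Y1 = Y0 - F' - eps * P' -> g0 = X0 + Y0 ->
    0 <= F + F' -> g1 <= g0 - eps * (P + P').
  by move=> -> -> -> ->; lra.
exact: (step _ _ _ _ _ _ _ _ _ _ (sE k.+1) (value_difference_step M M' kN)
  (value_difference_step M' M kN) (sE k) fmono).
Qed.

Let gain_ge0 k : (k <= Nt)%N -> 0 <= gain k.
Proof.
move=> kN; rewrite -(subKn kN); move: (Nt - k)%N (leq_subr k Nt) => {k kN}.
elim=> [_|j IH jN].
  rewrite subn0 /gain.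
  under eq_bigr do rewrite !V_terminal.
  apply: monotone_flow => // p; have fN : finite_set (st (inord Nt : 'I_Nt.+1)).
    by apply: finite_states; rewrite -ltnS.
  by apply: (continuous_slice fN (e := id) (l := gT D) (D := setT)) => // x.
have kN : (Nt - j.+1 < Nt)%N by rewrite ltn_subrL.
have := gain_step kN; rewrite subnSK// => /(le_trans (IH (ltnW jN))).
move=> /le_trans; apply; rewrite gerBl mulr_ge0 ?(ltW heps)//.
by rewrite addr_ge0// policy_gap_ge0.
Qed.

Let gain_le0 k : (k <= Nt)%N -> gain k <= 0.
Proof.
elim: k => [_|k IH kN].
  by rewrite /gain big1// => x _; rewrite (best_response0 M M') subrr mul0r.
apply: (le_trans (gain_step kN)); apply: (le_trans _ (IH (ltnW kN))).
by rewrite gerBl mulr_ge0 ?(ltW heps)// addr_ge0// policy_gap_ge0.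
Qed.

(** Since [gain k <= 0 <= gain k.+1], [gain_step] leaves no room for a positive gap. *)
Let policy_gap_eq0 k : (k < Nt)%N -> policy_gap M M' k = 0.
Proof.
have zero (g1 g0 P P' : R) : g1 <= g0 - eps * (P + P') -> 0 <= g1 -> g0 <= 0 ->
    0 <= P -> 0 <= P' -> P = 0.
  move=> g10 g1_0 g0_0 P0 P'0; have : eps * (P + P') <= 0 by lra.
  by rewrite pmulr_rle0//; lra.
move=> kN; apply: (zero _ _ _ _ (gain_step kN) (gain_ge0 kN) (gain_le0 (ltnW kN)));
  exact: policy_gap_ge0.
Qed.

Let best_response_eq k : (k <= Nt)%N ->
  best_response eps M k = best_response eps M' k.
Proof.
elim: k => [_|k IH kN]; first exact: best_response0.
have {}IH := IH (ltnW kN).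
apply/funext => y; rewrite (best_responseS M y kN) (best_responseS M' y kN).
apply: eq_big_seq => x xs.
have xk := mem_states (ltnW kN) xs.
rewrite -(congr1 (fun b => b x) IH); have /eqP := policy_gap_eq0 kN.
rewrite /policy_gap big_seq.
rewrite psumr_eq0 => [/allP/(_ x xs)/implyP/(_ xs)|x' /(mem_states (ltnW kN)) x'k];
  last first.
  apply: mulr_ge0; last exact: relative_entropy_policy_ge0.
  by have [] := best_response_prob M (ltnW kN).
(* Either [x] carries no mass and contributes nothing, or the two policies at [x] agree, and with
   them the transitions. *)
rewrite mulf_eq0 => /orP[/eqP br0|/eqP RE0]; first by rewrite br0 [LHS]mulr0 mulr0.
have pp : policy eps M k x = policy eps M' k x.
  apply: (relative_entropy_eq0 _ _ _ _ RE0); [exact: finite_S1|exact: policy_prob..|].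
  by move=> y1; exact: policy_gt0.
by rewrite /transition pp.
Qed.

Lemma equilibrium_unique : M = M'.
Proof.
apply: functional_extensionality_dep => k.
have kN : (k <= Nt)%N by rewrite -ltnS.
have : fprob_val (M k) = fprob_val (M' k).
  apply/funext => x; have [xk|nxk] := pselect (st k x).
    rewrite (hM xk) (hM' xk); exact: (congr1 (fun b => b x) (best_response_eq kN)).
  by have [_ -> //] := fprob_prop (M k); have [_ -> //] := fprob_prop (M' k).
(* The weights agree on the states and vanish elsewhere; the proofs stored with them are identified
   by proof irrelevance. *)
case: (M k) => v P; case: (M' k) => v' P' /= vv'; case: _ / vv' in P' *.
by congr FProb; exact: Prop_irrelevance.
Qed.

End two_equilibria.
End uniqueness.

End finite_game.

Theorem theorem4p1 (R : realType) (r q : nat) (D : mfg_data R r q)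
    (p Cstar Cb CI : R) (Nt Ns : nat) (beta : 'cV[R]_q -> 'cV[R]_q -> R)
    (eps : R)
    (hT : 0 < horizon D)
    (hgrowth : growth_condition D p)
    (hdyn : dynamics_condition D)
    (hord : forall t, 0 <= t <= horizon D -> usubmx (ctrl D t) \in unitmx)
    (hsupp : support_condition D Cstar)
    (hCb : control_bound D p Cb)
    (hNt : (0 < Nt)%N) (hNs : (Nt <= Ns)%N)
    (hCI : 0 < CI) (hbeta : Q1_basis (dx Ns) CI beta)
    (heps : 0 < eps)
    (hreach : forall (k : nat) (x : 'cV[R]_(r + q)), (k < Nt)%N ->
       states D Cstar Cb Nt Ns beta k x ->
       reach D Cb Nt Ns beta k x !=set0)
    (hinit : prob_on (states D Cstar Cb Nt Ns beta 0)
       (init_mass D Cstar Cb Nt Ns beta)) :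
  (exists M : mfg_space D Cstar Cb Nt Ns beta, equilibrium eps M) /\
  (monotonicity_condition D p ->
     forall M M' : mfg_space D Cstar Cb Nt Ns beta,
       equilibrium eps M -> equilibrium eps M' -> M = M').
Proof.
have [_ hell _ hg _] := hgrowth; split.
  exact: (exists_equilibrium hT hNt hNs hord hbeta heps hreach hinit hell hg).
move=> [l0 [f [hl _ [hfc _ _] hfm hgm]]] M M' hM hM'.
exact: (equilibrium_unique hT hNt hNs hord hbeta heps hreach hinit hl hfc hfm hg hgm
  hM hM').
Qed.
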